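(* Let $d\in\{2,3\}$ and consider a network of $N\ge2$ grains in which each grain has a distinct orientation, with grain boundary surface tensions given by the Read–Shockley model described in the context (model (RS2) if $d=2$; model (RS3) with $\theta_*\le\pi/4$ if $d=3$), and with equal mobilities $\mu_{i,j}=1$ for all $i\ne j$. Let $\alpha>\beta>0$ satisfy $\alpha\ge\max_{i\ne j}\sigma_{i,j}$, $\beta\le\min_{i\ne j}\sigma_{i,j}$, and \[ \alpha\ge\frac{\min_i s_i}{\max_i m_i},\qquad \beta\le\frac{\max_i s_i}{\min_i m_i}, \] where $s_1,\dots,s_{N-1}$, $m_1,\dots,m_{N-1}$ are the eigenvalues on $e^\perp$ of $J\sigma J$ and $J\mathbf{M}J$ respectively, $\mathbf M$ being the matrix with zero diagonal and all off-diagonal entries equal to $1$ (the reciprocal mobility matrix), $e=(1,\dots,1)^T$, $J=I-\frac1Nee^T$. Then for every $\delta t>0$ Algorithm 4 (described in the context) with kernels $K_{i,j}=a_{i,j}G_{\sqrt\alpha}+b_{i,j}G_{\sqrt\beta}$ is unconditionally gradient stable: $E_{\sqrt{\delta t}}(\boldsymbol\Sigma^{k+1},\boldsymbol K)\le E_{\sqrt{\delta t}}(\boldsymbol\Sigma^{k},\boldsymbol K)$ for every $k$ (equivalently for the relaxed energy evaluated at the characteristic functions of the phases).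
   Context: Read–Shockley model in 2D (RS2): grain $i$ has orientation $\theta_i\in(-\pi/4,\pi/4]$ (endpoints of $[-\pi/4,\pi/4]$ identified; distinct orientations means $\theta_i\ne\theta_j$ for $i\ne j$), and $\sigma_{i,j}=\min_{k\in\mathbb Z}f(|\theta_i-\theta_j+k\pi/2|)$, where $f:[0,\infty)\to\mathbb R$ is not identically zero and satisfies: (H1) $f\in C([0,\infty))\cap C^2((0,\infty))$ and $\lim_{\xi\to0^+}\xi^2f'(\xi)=0$; (H2) $f(0)=0$, $f\ge0$; (H3) $f'(\xi)\ge0$ for $\xi>0$; (H4) $f''(\xi)\le0$ for $\xi>0$. Read–Shockley model in 3D (RS3): grain $i$ has orientation $g_i\in SO(3)$; for $g\in SO(3)$ let $\theta(g)\in[0,\pi]$ be its rotation angle, $\mathcal O$ the octahedral group of rotational symmetries of the cube, $\theta_{\mathcal O}(g)=\min_{r\in\mathcal O}\theta(rg)$; distinct orientations means $\theta_{\mathcal O}(g_ig_j^T)>0$ for $i\ne j$; the misorientation is $\theta_{i,j}=\theta_{\mathcal O}(g_ig_j^T)$ and $\sigma_{i,j}=f(\theta_{i,j})$ with $f(\theta)=\frac{\theta}{\theta_*}\left(1-\log\frac{\theta}{\theta_*}\right)$ for $\theta<\theta_*$ and $f(\theta)=1$ for $\theta\ge\theta_*$, $\theta_*>0$ a fixed constant. Domain $D$: a flat torus in $\mathbb R^d$; convolutions periodic. $G_{\sqrt\gamma}(x)=(4\pi\gamma)^{-d/2}\exp(-|x|^2/(4\gamma))$; $K_\epsilon(x)=\epsilon^{-d}K(x/\epsilon)$.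 Coefficients: $a_{i,j}=\frac{\sqrt{\pi}\sqrt{\alpha}}{\alpha-\beta}(\sigma_{i,j}-\beta\mu_{i,j}^{-1})$, $b_{i,j}=\frac{\sqrt{\pi}\sqrt{\beta}}{\alpha-\beta}(-\sigma_{i,j}+\alpha\mu_{i,j}^{-1})$. Algorithm 4: from a partition $\boldsymbol\Sigma^k$ of $D$ compute $\psi_i^k=\sum_{j\ne i}\big(a_{i,j}G_{\sqrt{\alpha\delta t}}*\mathbf 1_{\Sigma^k_j}+b_{i,j}G_{\sqrt{\beta\delta t}}*\mathbf 1_{\Sigma^k_j}\big)$ and set $\Sigma_i^{k+1}=\{x:\psi_i^k(x)<\min_{j\ne i}\psi_j^k(x)\}$ (ties assigned to one minimizing index). Energy: $E_{\sqrt{\delta t}}(\boldsymbol\Sigma,\boldsymbol K)=\frac{1}{\sqrt{\delta t}}\sum_{i\ne j}\int_{\Sigma_j}(K_{i,j})_{\sqrt{\delta t}}*\mathbf 1_{\Sigma_i}\,dx$; relaxed version for $\boldsymbol u\in\mathcal K=\{\boldsymbol u\in L^1(D,[0,1]^N):\sum_iu_i=1\text{ a.e.}\}$: $E_{\sqrt{\delta t}}(\boldsymbol u,\boldsymbol K)=\frac{1}{\sqrt{\delta t}}\sum_{i\ne j}\int_D u_j(K_{i,j})_{\sqrt{\delta t}}*u_i\,dx$. *)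

(* Defs.v *)
From HB Require Import structures.
From mathcomp Require Import all_boot all_order all_algebra.
From mathcomp Require Import all_classical all_reals all_analysis.
Set Implicit Arguments.
Unset Strict Implicit.
Unset Printing Implicit Defensive.
Import Order.TTheory GRing.Theory Num.Theory.
Import numFieldNormedType.Exports.
Local Open Scope classical_set_scope.
Local Open Scope ring_scope.

(* Generic Euclidean geometry data: a measurable type T carrying a     *)
(* measure mu (Lebesgue measure on R^dim), with coordinates            *)
(* coord : T -> 'I_dim -> R and the inverse constructor mk.            *)
Section Generic.
Variables (R : realType) (dT : measure_display) (T : measurableType dT).
Variable (mu : {measure set T -> \bar R}).
Variable (dim : nat) (coord : T -> 'I_dim -> R) (mk : ('I_dim -> R) -> T).

Definition vsub (x y : T) : T := mk (fun i => coord x i - coord y i).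
Definition vadd (x y : T) : T := mk (fun i => coord x i + coord y i).
Definition vscale (a : R) (x : T) : T := mk (fun i => a * coord x i).
Definition sqnorm (x : T) : R := \sum_(i < dim) coord x i ^+ 2.

(* flat torus R^dim / B Z^dim, B invertible: lattice and fundamental domain *)
Definition lattice (B : 'M[R]_dim) : set T :=
  [set x | exists k : 'I_dim -> int,
     forall i, coord x i = \sum_(j < dim) B i j * (k j)%:~R].
Definition fund_domain (B : 'M[R]_dim) : set T :=
  [set x | exists t : 'I_dim -> R, (forall j, 0 <= t j < 1) /\
     forall i, coord x i = \sum_(j < dim) B i j * t j].

Definition gauss (g : R) (x : T) : R :=
  (4 * pi * g) `^ (- (dim%:R / 2)) * expR (- sqnorm x / (4 * g)).

Definition rescale (eps : R) (K : T -> R) (x : T) : R :=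
  eps ^- dim * K (vscale eps^-1 x).

(* periodic convolution (K * 1_S)(x) = int_{R^dim} K(x - y) 1_S(y) dy,
   where S is a lattice-periodic subset of R^dim (a subset of the torus) *)
Definition conv (K : T -> R) (S : set T) (x : T) : \bar R :=
  (\int[mu]_(y in S) (K (vsub x y))%:E)%E.

Variable N : nat.
Variables (sigma mob : 'I_N -> 'I_N -> R) (alpha beta : R).

Definition acoef (i j : 'I_N) : R :=
  Num.sqrt pi * Num.sqrt alpha / (alpha - beta) * (sigma i j - beta * (mob i j)^-1).
Definition bcoef (i j : 'I_N) : R :=
  Num.sqrt pi * Num.sqrt beta / (alpha - beta) * (- sigma i j + alpha * (mob i j)^-1).

Definition kernel (i j : 'I_N) (x : T) : R :=
  acoef i j * gauss alpha x + bcoef i j * gauss beta x.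

Variables (B : 'M[R]_dim) (dt : R).

Definition energy (S : 'I_N -> set T) : \bar R :=
  ((Num.sqrt dt)^-1)%:E *
  (\sum_(i < N) \sum_(j < N | j != i)
     \int[mu]_(x in fund_domain B `&` S j)
        conv (rescale (Num.sqrt dt) (kernel i j)) (S i) x)%E.

Definition psi (S : 'I_N -> set T) (i : 'I_N) (x : T) : R :=
  \sum_(j < N | j != i)
    (acoef i j * fine (conv (gauss (alpha * dt)) (S j) x)
     + bcoef i j * fine (conv (gauss (beta * dt)) (S j) x)).

Definition is_partition (S : 'I_N -> set T) : Prop :=
  (forall i, measurable (S i)) /\
  (forall i x l, lattice B l -> (S i x <-> S i (vadd x l))) /\
  (forall x, exists! i, S i x).

(* one step of Algorithm 4: Sigma^{k+1}_i contains the points where psi_i is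
   strictly smallest, ties being assigned to one minimizing index *)
Definition alg4_step (S S' : 'I_N -> set T) : Prop :=
  is_partition S' /\
  forall i x, S' i x -> forall j, psi S i x <= psi S j x.

Definition gradient_stable : Prop :=
  forall Sig : nat -> 'I_N -> set T,
    is_partition (Sig 0%N) ->
    (forall k, alg4_step (Sig k) (Sig k.+1)) ->
    forall k, (energy (Sig k.+1) <= energy (Sig k))%E.

End Generic.

Section Cond.
Variables (R : realType) (N : nat).

Definition sigma_mx (sigma : 'I_N -> 'I_N -> R) : 'M[R]_N :=
  \matrix_(i, j) (if i == j then 0 else sigma i j).
(* reciprocal mobility matrix for unit mobilities *)
Definition mob_mx : 'M[R]_N := \matrix_(i, j) (if i == j then 0 else 1).
Definition Jmx : 'M[R]_N := 1%:M - (N%:R)^-1 *: const_mx 1.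

Definition eig_perp (A : 'M[R]_N) : set R :=
  [set s | exists v : 'cV[R]_N,
     v != 0 /\ \sum_(i < N) v i ord0 = 0 /\ A *m v = s *: v].

Definition is_least (S : set R) (a : R) := S a /\ forall b, S b -> a <= b.
Definition is_greatest (S : set R) (a : R) := S a /\ forall b, S b -> b <= a.

Definition ab_cond (sigma : 'I_N -> 'I_N -> R) (alpha beta : R) : Prop :=
  0 < beta /\ beta < alpha /\
  (forall i j, i != j -> beta <= sigma i j <= alpha) /\
  (forall smin mmax,
     is_least (eig_perp (Jmx *m sigma_mx sigma *m Jmx)) smin ->
     is_greatest (eig_perp (Jmx *m mob_mx *m Jmx)) mmax ->
     smin / mmax <= alpha) /\
  (forall smax mmin,
     is_greatest (eig_perp (Jmx *m sigma_mx sigma *m Jmx)) smax ->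
     is_least (eig_perp (Jmx *m mob_mx *m Jmx)) mmin ->
     beta <= smax / mmin).
End Cond.

Section RS.
Variable R : realType.

Definition RS2_f (f : R -> R) : Prop :=
  {within `[0, +oo[, continuous f} /\
  (forall x, 0 < x -> derivable f x 1) /\
  (forall x, 0 < x -> derivable (derive1 f) x 1) /\
  {in `]0, +oo[, continuous (derive1n 2 f)} /\
  (fun x => x ^+ 2 * (derive1 f) x) @ 0^'+ --> 0 /\
  f 0 = 0 /\ (forall x, 0 <= x -> 0 <= f x) /\
  (forall x, 0 < x -> 0 <= (derive1 f) x) /\
  (forall x, 0 < x -> (derive1n 2 f) x <= 0) /\
  (exists x, 0 <= x /\ f x != 0).

Definition sigma2 N (f : R -> R) (theta : 'I_N -> R) (i j : 'I_N) : R :=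
  inf [set f `|theta i - theta j + k%:~R * (pi / 2)| | k in [set: int]].

Definition SO3 (g : 'M[R]_3) : Prop := g *m g^T = 1%:M /\ \det g = 1.
Definition rot_angle (g : 'M[R]_3) : R := acos ((\tr g - 1) / 2).
(* octahedral group: rotations mapping the cube [-1,1]^3 to itself,
   i.e. signed permutation matrices of determinant 1 *)
Definition octa (r : 'M[R]_3) : Prop :=
  SO3 r /\ forall i j, r i j = -1 \/ r i j = 0 \/ r i j = 1.
Definition thetaO (g : 'M[R]_3) : R :=
  inf [set rot_angle (r *m g) | r in octa].
Definition fRS3 (ts th : R) : R :=
  if th < ts then th / ts * (1 - ln (th / ts)) else 1.
Definition sigma3 N (ts : R) (g : 'I_N -> 'M[R]_3) (i j : 'I_N) : R :=
  fRS3 ts (thetaO (g i *m (g j)^T)).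
End RS.

Section Concrete.
Variable R : realType.
Definition pt2 := (measurableTypeR R * measurableTypeR R)%type.
Definition pt3 := ((measurableTypeR R * measurableTypeR R) * measurableTypeR R)%type.
Definition leb2 := (@lebesgue_measure R \x @lebesgue_measure R)%E.
Definition leb3 := ((@lebesgue_measure R \x @lebesgue_measure R) \x @lebesgue_measure R)%E.
Definition coord2 (x : pt2) (i : 'I_2) : R :=
  if val i == 0%N then x.1 else x.2.
Definition mk2 (c : 'I_2 -> R) : pt2 := (c (inord 0), c (inord 1)).
Definition coord3 (x : pt3) (i : 'I_3) : R :=
  match val i with 0%N => x.1.1 | 1%N => x.1.2 | _ => x.2 end.
Definition mk3 (c : 'I_3 -> R) : pt3 := ((c (inord 0), c (inord 1)), c (inord 2)).
End Concrete.

(* Main.v *)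
Require Import Defs.
From HB Require Import structures.
From mathcomp Require Import all_boot all_order all_algebra.
From mathcomp Require Import all_classical all_reals all_analysis.
From mathcomp Require Import measurable_realfun ring lra.
Import Order.TTheory GRing.Theory Num.Theory.
Import numFieldNormedType.Exports.
Local Open Scope classical_set_scope.
Local Open Scope ring_scope.

(** The inner convolution runs over all of space and the outer integral over one period, so the
    energy is not visibly symmetric in the two sets. Moving the cut-off to the intermediate variable
    of the convolution square repairs this: the result is an inner product on [D]. The phases sum to
    1, so the convolved differences between two partitions sum to zero at every point, and the
    matrix inequality can be applied pointwise under the integral. Two symmetries, of the tensions
    in their indices and of the heat content in its sets, merge the two cross terms into twice the
    linearization. On zero-sum vectors [a] is a positive multiple of [sigma + beta] and [b] of
    [-(sigma + alpha)], while the eigenvalue conditions read [-alpha <= smin] and [smax <= -beta].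
    These conditions speak of numbers already known to be least or greatest eigenvalues, so such
    eigenvalues must first be shown to exist; maximizing the Rayleigh form on the compact unit
    sphere of zero-sum vectors produces them. *)

(* The one-step energy change is the second-order part of the quadratic energy
   plus twice its linearization, and the latter is nonpositive because the
   scheme minimizes the linearization pointwise. Each Gaussian is, up to a
   positive factor, the convolution square of a narrower one; unfolding the torus
   turns [int_D 1_A (G * 1_C)] into [int_D (H * 1_A) (H * 1_C)], so it suffices
   that the matrices [a] and [b] be negative semidefinite on vectors of zero sum.
   Since [M] acts as [-1] there, this is exactly what the two eigenvalue
   conditions on [alpha] and [beta] say. *)

(** * Gaussian convolutions on a flat torus *)

Section Periodic.
Variables (R : realType) (dT : measure_display) (T : measurableType dT).
Variable (mu : {sigma_finite_measure set T -> \bar R}).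
Variable (dim : nat) (coord : T -> 'I_dim -> R) (mk : ('I_dim -> R) -> T).
(** The space is kept abstract so that the plane and three-space are instances of one argument:
    coordinates, translation invariance for nonnegative integrands, and the Gaussian mass bounds
    below. *)
Hypothesis mkK : forall c i, coord (mk c) i = c i.
Hypothesis coord_inj : forall x y, (forall i, coord x i = coord y i) -> x = y.
Hypothesis measurable_coord :
  forall i, measurable_fun setT (fun x => coord x i).
Hypothesis measurable_mk :
  forall d (S : measurableType d) (c : S -> 'I_dim -> R),
    (forall i, measurable_fun setT (fun s => c s i)) ->
    measurable_fun setT (fun s => mk (c s)).
Hypothesis ge0_integral_shift : forall (F : T -> \bar R) (l : T),
  measurable_fun setT F -> (forall x, 0 <= F x)%E ->
  (\int[mu]_x F (vadd coord mk x l) = \int[mu]_x F x)%E.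

Local Notation "x :+: y" := (vadd coord mk x y) (at level 50, left associativity).
Local Notation "x :-: y" := (vsub coord mk x y) (at level 50, left associativity).
Local Notation nrm := (sqnorm coord).

(** Unnormalized Gaussian indexed by its exponent, so that the semigroup law involves simple
    multiples of [c]; the normalization returns with [gconst]. *)
Definition gexp (c : R) (x : T) : R := expR (- (c * nrm x)).

Hypothesis gexp_int : forall c : R, 0 < c ->
  (0 < \int[mu]_x (gexp c x)%:E < +oo)%E.

Lemma ge0_integral_indic (A : set T) (f : T -> \bar R) :
  (\int[mu]_(x in A) f x = \int[mu]_x ((\1_A x)%:E * f x))%E.
Proof.
rewrite integral_mkcond epatch_indic.
by apply: eq_integral => x _ /=; rewrite muleC.
Qed.

Lemma measurable_indicE (A : set T) : measurable A ->
  measurable_fun setT (fun x => \1_A x : R).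
Proof. by move=> mA; exact: measurable_indic. Qed.

Lemma measurable_vsub d (S : measurableType d) (f g : S -> T) :
  measurable_fun setT f -> measurable_fun setT g ->
  measurable_fun setT (fun s => f s :-: g s).
Proof.
move=> mf mg; apply: measurable_mk => i; apply: measurable_funB.
- exact: (measurableT_comp (measurable_coord i) mf).
- exact: (measurableT_comp (measurable_coord i) mg).
Qed.

Lemma measurable_gexp c : measurable_fun setT (gexp c).
Proof.
apply: measurableT_comp => //; apply: measurableT_comp => //.
apply: measurable_funM => //.
apply: measurable_sum => i; apply: measurable_funX; exact: measurable_coord.
Qed.

Lemma measurable_gexp_sub c d (S : measurableType d) (f g : S -> T) :
  measurable_fun setT f -> measurable_fun setT g ->
  measurable_fun setT (fun s => gexp c (f s :-: g s)).
Proof.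
move=> mf mg; apply: measurableT_comp; first exact: measurable_gexp.
exact: measurable_vsub.
Qed.

Lemma gexp_ge0 c x : 0 <= gexp c x. Proof. exact: expR_ge0. Qed.

Lemma gexp_subC c x y : gexp c (x :-: y) = gexp c (y :-: x).
Proof.
rewrite /gexp /sqnorm; congr (expR (- (c * _))).
by apply: eq_bigr => i _; rewrite !mkK; ring.
Qed.

Lemma vadd_subK x y l : (x :+: l) :-: (y :+: l) = x :-: y.
Proof. by apply: coord_inj => i; rewrite !mkK; ring. Qed.

Lemma ge0_integral_gexp_sub c y :
  (\int[mu]_x (gexp c (x :-: y))%:E = \int[mu]_x (gexp c x)%:E)%E.
Proof.
rewrite -(ge0_integral_shift (fun x => (gexp c (x :-: y))%:E) y).
- apply: eq_integral => x _; congr (gexp c _)%:E.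
  by apply: coord_inj => i; rewrite !mkK; ring.
- apply/measurable_EFinP; apply: measurable_gexp_sub => //.
- by move=> x; rewrite lee_fin gexp_ge0.
Qed.

(* Complete the square at the midpoint [m] of [x] and [y]:
   2|x-z|^2 + 2|z-y|^2 = |x-y|^2 + 4|z-m|^2. *)
Lemma gexp_semigroup c x y : 0 < c ->
  (\int[mu]_z (gexp (2 * c) (x :-: z) * gexp (2 * c) (z :-: y))%:E =
   (gexp c (x :-: y))%:E * \int[mu]_z (gexp (4 * c) z)%:E)%E.
Proof.
move=> c0; pose m := mk (fun i => (coord x i + coord y i) / 2).
transitivity (\int[mu]_z
  ((gexp c (x :-: y))%:E * (gexp (4 * c) (z :-: m))%:E))%E; last first.
  rewrite -(ge0_integral_gexp_sub (4 * c) m).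
  apply: (@ge0_integralZl _ _ _ mu _ measurableT
           (fun z => (gexp (4 * c) (z :-: m))%:E)).
  - by apply/measurable_EFinP; apply: measurable_gexp_sub.
  - by move=> z _; rewrite lee_fin gexp_ge0.
  - by rewrite lee_fin gexp_ge0.
apply: eq_integral => z _; rewrite -EFinM; congr _%:E.
rewrite /gexp -!expRD; congr expR.
rewrite -!opprD; congr (- _); rewrite /sqnorm !mulr_sumr -!big_split /=.
by apply: eq_bigr => i _; rewrite !mkK; field.
Qed.

(** * Lattice cells, tilings and unfolding *)

Variable B : 'M[R]_dim.
Hypothesis detB : \det B != 0.

Definition lvec (k : {ffun 'I_dim -> int}) : T :=
  mk (fun i => \sum_(j < dim) B i j * (k j)%:~R).
Definition frac_coord (x : T) (j : 'I_dim) : R :=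
  \sum_(i < dim) invmx B j i * coord x i.
(** Integer part of [B^-1 x]. Its level sets are the lattice translates of the fundamental domain,
    so tiling questions become arithmetic on integer vectors. *)
Definition cell (x : T) : {ffun 'I_dim -> int} :=
  [ffun j => Num.floor (frac_coord x j)].
Local Notation D := (fund_domain coord B).

Lemma unitB : B \in unitmx. Proof. by rewrite unitmxE unitfE. Qed.

Lemma lattice_lvec k : lattice coord B (lvec k).
Proof. by exists k => i; rewrite mkK. Qed.

Lemma sum_invmxl (t : 'I_dim -> R) j :
  \sum_(i < dim) invmx B j i * (\sum_(l < dim) B i l * t l) = t j.
Proof.
have := mulmxA (invmx B) B (\col_l t l); rewrite mulVmx ?unitB// mul1mx.
move=> /matrixP /(_ j ord0); rewrite !mxE => <-.
apply: eq_bigr => i _; rewrite !mxE; congr (_ * _).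
by apply: eq_bigr => l _; rewrite !mxE.
Qed.

Lemma sum_invmxr (t : 'I_dim -> R) j :
  \sum_(i < dim) B j i * (\sum_(l < dim) invmx B i l * t l) = t j.
Proof.
have := mulmxA B (invmx B) (\col_l t l); rewrite mulmxV ?unitB// mul1mx.
move=> /matrixP /(_ j ord0); rewrite !mxE => <-.
apply: eq_bigr => i _; rewrite !mxE; congr (_ * _).
by apply: eq_bigr => l _; rewrite !mxE.
Qed.

Lemma fund_domainE : D = [set x | cell x = 0].
Proof.
apply/seteqP; split => x /=.
  move=> [t [t01 xE]]; apply/ffunP => j; rewrite !ffunE.
  rewrite /frac_coord; under eq_bigr do rewrite xE.
  rewrite sum_invmxl; apply/eqP; rewrite floor_eq//.
move=> x0; exists (frac_coord x); split => [j|i]; last by rewrite sum_invmxr.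
have /ffunP/(_ j) := x0; rewrite !ffunE => f0.
by have := floor_itv (frac_coord x j); rewrite f0 add0r mulr1z mulr0z.
Qed.

Lemma cell_shift x k : cell (x :+: lvec k) = cell x + k.
Proof.
apply/ffunP => j; rewrite !ffunE.
have -> : frac_coord (x :+: lvec k) j = frac_coord x j + (k j)%:~R.
  rewrite /frac_coord -[X in _ + X](sum_invmxl (fun l => (k l)%:~R)) -big_split.
  by apply: eq_bigr => i _; rewrite !mkK mulrDr.
by rewrite floorDrz ?intrKfloor ?rpred_int.
Qed.

Lemma measurable_frac_coord j : measurable_fun setT (frac_coord ^~ j).
Proof.
apply: measurable_sum => i; apply: measurable_funM => //; exact: measurable_coord.
Qed.

Lemma measurable_cell k : measurable [set x | cell x = k].
Proof.
have -> : [set x | cell x = k] =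
    \bigcap_(j in [set: 'I_dim])
      ((frac_coord ^~ j) @^-1` `[(k j)%:~R, (k j + 1)%:~R[ ).
  apply/seteqP; split => x /=.
    by move=> <- j _ /=; rewrite in_itv /= !ffunE floor_itv.
  move=> xk; apply/ffunP => j; rewrite !ffunE; apply/eqP; rewrite floor_eq.
  by have := xk j I; rewrite /= in_itv.
apply: fin_bigcap_measurable => [|j _]; first exact: finite_finset.
by rewrite -[X in measurable X]setTI; apply: measurable_frac_coord.
Qed.

Lemma measurable_fund_domain : measurable D.
Proof. by rewrite fund_domainE; exact: measurable_cell. Qed.

(** The tiles are numbered by naturals through [pickle], to fit countable additivity; numbers
    outside the range give empty tiles. The relabelling [s] serves the unfolding, which uses both
    the identity and the opposite. *)
Definition tile (s : {ffun 'I_dim -> int} -> {ffun 'I_dim -> int}) (n : nat) :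
  set T := [set x | choice.pickle (s (cell x)) = n].

Lemma measurable_tile s n : measurable (tile s n).
Proof.
have -> : tile s n = \bigcup_m
    (if choice.unpickle m is Some k then
       [set x | cell x = k /\ choice.pickle (s k) = n] else set0).
  apply/seteqP; split => x /=.
    by move=> xn; exists (choice.pickle (cell x)) => //; rewrite choice.pickleK.
  by move=> [m _]; case: (choice.unpickle m) => // k [<-].
apply: bigcup_measurable => m _; case: (choice.unpickle m) => // k.
have [<-|kn] := eqVneq (choice.pickle (s k)) n.
  rewrite (_ : [set x | _] = [set x | cell x = k]); first exact: measurable_cell.
  by apply/seteqP; split => x /= => [[]//|].
rewrite (_ : [set x | _] = set0)//; apply/seteqP; split => x //= [_ /eqP].
by rewrite (negbTE kn).
Qed.

Lemma ge0_integral_tile s (F : T -> \bar R) :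
  measurable_fun setT F -> (forall x, 0 <= F x)%E ->
  (\int[mu]_x F x =
   \sum_(0 <= n <oo) \int[mu]_x ((\1_(tile s n) x)%:E * F x))%E.
Proof.
move=> mF F0.
have tE : \bigcup_n tile s n = setT.
  by apply/seteqP; split => x //= _; exists (choice.pickle (s (cell x))).
transitivity ((\int[mu]_(x in \bigcup_n tile s n) F x)%E); first by rewrite tE.
rewrite ge0_integral_bigcup ?tE//; last 2 first.
- by move=> n; exact: measurable_tile.
- by move=> i j _ _ [x [/= <- <-]].
by apply: eq_eseriesr => n _; exact: ge0_integral_indic.
Qed.

Lemma indic_iff (X Y : Type) (A : set X) (C : set Y) x y :
  (A x <-> C y) -> \1_A x = \1_C y :> R.
Proof.
move=> AC; rewrite !indicE; congr (nat_of_bool _)%:R.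
by apply/idP/idP; rewrite !inE => /AC.
Qed.

(* Tile the space of [z] by the translates of [D], shift both variables by the
   corresponding lattice vector, and reassemble the tiles of [x]. *)
Lemma unfolding (F : T -> T -> \bar R) :
  measurable_fun setT (fun p : T * T => F p.1 p.2) ->
  (forall x z, 0 <= F x z)%E ->
  (forall x z l, lattice coord B l -> F (x :+: l) (z :+: l) = F x z) ->
  (\int[mu]_x \int[mu]_z ((\1_D x)%:E * F x z) =
   \int[mu]_z \int[mu]_x ((\1_D z)%:E * F x z))%E.
Proof.
move=> mF F0 Fl.
have mD := measurable_fund_domain.
have ind0 (A : set T) x : (0 <= (\1_A x : R)%:E)%E.
  by rewrite lee_fin indicE.
have m1 (A : set T) d (S : measurableType d) (f : S -> T) : measurable A ->
    measurable_fun setT f -> measurable_fun setT (fun s => (\1_A (f s))%:E : \bar R).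
  move=> mA mf; apply/measurable_EFinP.
  exact: (measurableT_comp (measurable_indicE _ mA) mf).
have mAF (A A' : set T) : measurable A -> measurable A' ->
    measurable_fun setT (fun p : T * T => (\1_A p.1)%:E * (\1_A' p.2)%:E * F p.1 p.2)%E.
  move=> mA mA'; apply: emeasurable_funM => //.
  by apply: emeasurable_funM; apply: m1.
have AF0 (A A' : set T) (p : T * T) :
    (0 <= (\1_A p.1)%:E * (\1_A' p.2)%:E * F p.1 p.2)%E by rewrite !mule_ge0.
transitivity (\sum_(0 <= n <oo)
  \int[mu]_x \int[mu]_z ((\1_D x)%:E * (\1_(tile id n) z)%:E * F x z))%E.
  rewrite -integral_nneseries//; last 2 first.
  - by move=> n; apply: (measurable_fun_fubini_tonelli_F _ (mAF _ _ _ _)) => //;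
      exact: measurable_tile.
  - by move=> n x _; apply: integral_ge0 => z _; exact: (AF0 _ _ (x, z)).
  apply: eq_integral => x _; rewrite (ge0_integral_tile id).
  - by apply: eq_eseriesr => n _; apply: eq_integral => z _; rewrite muleCA muleA.
  - by apply: emeasurable_funM => //; exact: (measurable_fun_pair2 x mF).
  - by move=> z; rewrite mule_ge0.
transitivity (\sum_(0 <= n <oo)
  \int[mu]_x \int[mu]_z ((\1_(tile -%R n) x)%:E * (\1_D z)%:E * F x z))%E.
  apply: eq_eseriesr => n _.
  (* A number that encodes no integer vector gives empty tiles, and both sides vanish. *)
  case nk : (choice.pickle_inv n : option {ffun 'I_dim -> int}) => [k|]; last first.
    have t0 s x : \1_(tile s n) x = 0 :> R.
      by rewrite indicE memNset//= => xn; move: nk; rewrite -xn choice.pickleK_inv.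
    by rewrite !integral0_eq// => x _; rewrite integral0_eq// => z _;
      rewrite t0 ?mul0e ?mule0 ?mul0e.
  have nE : n = choice.pickle k.
    by have := @choice.pickle_invK {ffun 'I_dim -> int} n; rewrite nk.
  pose H x z := ((\1_D x)%:E * (\1_(tile id n) z)%:E * F x z)%E.
  have mH : measurable_fun setT (fun p : T * T => H p.1 p.2).
    by apply: mAF => //; exact: measurable_tile.
  have H0 x z : (0 <= H x z)%E by exact: (AF0 _ _ (x, z)).
  (* Both variables are shifted by [lvec k]. The shifted [x] lies in [D] exactly when
     [- cell x = k], and the shifted [z] lies in the tile of [k] exactly when [z] lies in [D]; this
     is where the tiling by [-%R] comes from. *)
  rewrite -[LHS](ge0_integral_shift (fun x => \int[mu]_z H x z)%E (lvec k));
    last 2 first.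
  - exact: (measurable_fun_fubini_tonelli_F _ mH).
  - by move=> x; exact: integral_ge0.
  apply: eq_integral => x _; rewrite -(ge0_integral_shift _ (lvec k)); last 2 first.
  - exact: (measurable_fun_pair2 (x :+: lvec k) mH).
  - by move=> z.
  apply: eq_integral => z _; rewrite /H Fl; last exact: lattice_lvec.
  congr (_%:E * _%:E * _)%E; rewrite fund_domainE; apply: indic_iff => /=.
    rewrite cell_shift nE; split=> [/eqP|/(pcan_inj choice.pickleK) <-];
      last by rewrite addrN.
    by rewrite addr_eq0 /tile /= => /eqP ->; rewrite opprK.
  rewrite /tile /= cell_shift nE; split=> [|->]; last by rewrite add0r.
  by move=> /(pcan_inj choice.pickleK) /eqP; rewrite -subr_eq0 addrK => /eqP.
transitivity (\sum_(0 <= n <oo)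
  \int[mu]_z \int[mu]_x ((\1_(tile -%R n) x)%:E * (\1_D z)%:E * F x z))%E.
  apply: eq_eseriesr => n _.
  apply: (fubini_tonelli
    (fun p => (\1_(tile -%R n) p.1)%:E * (\1_D p.2)%:E * F p.1 p.2))%E => //.
  by apply: mAF => //; exact: measurable_tile.
rewrite -integral_nneseries//; last 2 first.
- by move=> n; apply: (measurable_fun_fubini_tonelli_G _ (mAF _ _ _ _)) => //;
    exact: measurable_tile.
- by move=> n z _; apply: integral_ge0 => x _; exact: (AF0 _ _ (x, z)).
apply: eq_integral => z _; rewrite (ge0_integral_tile -%R).
- by apply: eq_eseriesr => n _; apply: eq_integral => x _; rewrite muleA.
- by apply: emeasurable_funM => //; exact: (measurable_fun_pair1 z mF).
- by move=> x; rewrite mule_ge0.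
Qed.

(** * Convolutions of periodic sets and heat content *)

Definition periodic (A : set T) : Prop :=
  forall x l, lattice coord B l -> (A x <-> A (x :+: l)).

Local Notation cv c A := (Defs.conv mu coord mk (gexp c) A).
Local Notation mass c := (\int[mu]_x (gexp c x)%:E)%E.

Lemma convE c (A : set T) z : cv c A z = (\int[mu]_y (\1_A y * gexp c (z :-: y))%:E)%E.
Proof.
rewrite [LHS]ge0_integral_indic.
by apply: eq_integral => y _; rewrite EFinM.
Qed.

Lemma conv_ge0 c A z : (0 <= cv c A z)%E.
Proof. by apply: integral_ge0 => y _; rewrite lee_fin gexp_ge0. Qed.

Lemma measurable_conv_integrand c A : measurable A ->
  measurable_fun setT (fun p : T * T => \1_A p.2 * gexp c (p.1 :-: p.2) : R).
Proof.
move=> mA; apply: measurable_funM; last exact: measurable_gexp_sub.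
exact: (measurableT_comp (measurable_indicE _ mA)).
Qed.

Lemma indic_gexp_ge0 c (A : set T) x z : 0 <= \1_A x * gexp c z.
Proof. by rewrite mulr_ge0 ?gexp_ge0// indicE. Qed.

Lemma measurable_conv c A : measurable A -> measurable_fun setT (cv c A).
Proof.
move=> mA; rewrite (_ : cv c A = fun z => \int[mu]_y (\1_A y * gexp c (z :-: y))%:E)%E.
  apply: (measurable_fun_fubini_tonelli_F (fun p => (\1_A p.2 * gexp c (p.1 :-: p.2))%:E)).
    by apply/measurable_EFinP; exact: measurable_conv_integrand.
  by move=> p; rewrite lee_fin indic_gexp_ge0.
by apply/funext => z; exact: convE.
Qed.

Lemma conv_periodic c A z l : measurable A -> periodic A ->
  lattice coord B l -> cv c A (z :+: l) = cv c A z.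
Proof.
move=> mA pA ll; rewrite !convE -(ge0_integral_shift _ l).
- apply: eq_integral => y _; rewrite vadd_subK (indic_iff _ _ A A (y :+: l) y)//.
  by rewrite -pA.
- apply/measurable_EFinP.
  exact: (measurable_fun_pair2 (z :+: l) (measurable_conv_integrand _ _ mA)).
- by move=> y; rewrite lee_fin indic_gexp_ge0.
Qed.

Lemma conv_setT c z : cv c setT z = mass c.
Proof.
rewrite -(ge0_integral_gexp_sub c z); apply: eq_integral => y _.
by rewrite gexp_subC.
Qed.

(* The semigroup property splits the heat kernel between the two sets, and
   unfolding symmetrizes the result. *)
Lemma heat_content c A C : 0 < c -> measurable A -> periodic A ->
  measurable C -> periodic C ->
  (\int[mu]_x ((\1_D x)%:E * ((\1_A x)%:E * cv c C x)) * mass (4 * c) =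
   \int[mu]_z ((\1_D z)%:E * (cv (2 * c) A z * cv (2 * c) C z)))%E.
Proof.
move=> c0 mA pA mC pC.
have mD := measurable_fund_domain.
have i0 (E : set T) x : (0 <= (\1_E x : R)%:E)%E by rewrite lee_fin indicE.
have mi (E : set T) : measurable E -> measurable_fun setT (fun x => (\1_E x)%:E : \bar R).
  by move=> mE; apply/measurable_EFinP; exact: measurable_indicE.
pose F x z := ((\1_A x * gexp (2 * c) (x :-: z))%:E * cv (2 * c) C z)%E.
have F0 x z : (0 <= F x z)%E.
  by rewrite mule_ge0 ?conv_ge0// lee_fin indic_gexp_ge0.
have mF : measurable_fun setT (fun p : T * T => F p.1 p.2).
  apply: emeasurable_funM; last first.
    by apply: (measurableT_comp (measurable_conv _ _ mC)); exact: measurable_snd.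
  apply/measurable_EFinP; apply: measurable_funM; last exact: measurable_gexp_sub.
  exact: (measurableT_comp (measurable_indicE _ mA)).
transitivity (\int[mu]_x \int[mu]_z ((\1_D x)%:E * F x z))%E.
  rewrite muleC -ge0_integralZl//; last 3 first.
  - apply: emeasurable_funM; [exact: mi|apply: emeasurable_funM; [exact: mi|]].
    exact: measurable_conv.
  - by move=> x _; rewrite !mule_ge0 ?conv_ge0.
  - by apply: integral_ge0 => x _; rewrite lee_fin gexp_ge0.
  apply: eq_integral => x _.
  rewrite (@ge0_integralZl _ _ _ mu _ measurableT (F x)); last 3 first.
  - exact: (measurable_fun_pair2 x mF).
  - by [].
  - exact: i0.
  rewrite muleCA; congr (_ * _)%E.
  (* With both convolutions written out, Tonelli lets [z] be integrated first, and the semigroup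
     identity turns the two narrow kernels into the wide one times [mass (4 * c)]. *)
  transitivity (\int[mu]_z \int[mu]_y
    ((\1_A x * gexp (2 * c) (x :-: z) * (\1_C y * gexp (2 * c) (z :-: y)))%:E))%E.
    have mG : measurable_fun setT (fun p : T * T =>
        \1_A x * gexp (2 * c) (x :-: p.1) * (\1_C p.2 * gexp (2 * c) (p.1 :-: p.2)) : R).
      apply: measurable_funM; last exact: measurable_conv_integrand.
      by apply: measurable_funM => //; exact: measurable_gexp_sub.
    rewrite (fubini_tonelli (fun p => (\1_A x * gexp (2 * c) (x :-: p.1) *
        (\1_C p.2 * gexp (2 * c) (p.1 :-: p.2)))%:E))//=; last 2 first.
    - exact/measurable_EFinP.
    - by move=> p; rewrite lee_fin mulr_ge0 ?indic_gexp_ge0.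
    transitivity (\int[mu]_y (((\1_A x)%:E * mass (4 * c)) *
        (\1_C y * gexp c (x :-: y))%:E))%E.
      rewrite convE muleA (muleC (mass _)); apply/esym.
      apply: (@ge0_integralZl _ _ _ mu _ measurableT
        (fun y => (\1_C y * gexp c (x :-: y))%:E)).
      - by apply/measurable_EFinP;
          exact: (measurable_fun_pair2 x (measurable_conv_integrand c C mC)).
      - by move=> y _; rewrite lee_fin indic_gexp_ge0.
      - by rewrite mule_ge0//; apply: integral_ge0 => y _; rewrite lee_fin gexp_ge0.
    apply: eq_integral => y _.
    transitivity ((\1_A x * \1_C y)%:E * \int[mu]_z
        (gexp (2 * c) (x :-: z) * gexp (2 * c) (z :-: y))%:E)%E.
      by rewrite gexp_semigroup// !EFinM muleACA (muleC (mass _)).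
    rewrite -(@ge0_integralZl _ _ _ mu _ measurableT
      (fun z => (gexp (2 * c) (x :-: z) * gexp (2 * c) (z :-: y))%:E)); last 3 first.
    - by apply/measurable_EFinP; apply: measurable_funM; exact: measurable_gexp_sub.
    - by move=> z _; rewrite lee_fin mulr_ge0 ?gexp_ge0.
    - by rewrite lee_fin mulr_ge0// indicE.
    by apply: eq_integral => z _; rewrite -EFinM; congr _%:E; ring.
  apply: eq_integral => z _; rewrite /F convE.
  rewrite -(@ge0_integralZl _ _ _ mu _ measurableT
    (fun y => (\1_C y * gexp (2 * c) (z :-: y))%:E)); last 3 first.
  - apply/measurable_EFinP.
    exact: (measurable_fun_pair2 z (measurable_conv_integrand _ _ mC)).
  - by move=> y _; rewrite lee_fin indic_gexp_ge0.
  - by rewrite lee_fin indic_gexp_ge0.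
  by apply: eq_integral => y _; rewrite -EFinM.
(* The cut-off moves from [x] to [z]. The remaining integral in [x] covers the whole space and is
   the narrow convolution of [A]. *)
rewrite (unfolding F mF F0); last first.
  move=> x z l ll; rewrite /F vadd_subK conv_periodic//.
  by rewrite (indic_iff _ _ A A (x :+: l) x)// -pA.
apply: eq_integral => z _.
rewrite (@ge0_integralZl _ _ _ mu _ measurableT (fun x => F x z)); last 3 first.
- exact: (measurable_fun_pair1 z mF).
- by [].
- exact: i0.
congr (_ * _)%E.
rewrite (@ge0_integralZr _ _ _ mu _ measurableT
  (fun x => (\1_A x * gexp (2 * c) (x :-: z))%:E)); last 3 first.
- by apply/measurable_EFinP; exact: (measurable_fun_pair1 z
    (measurable_funM (measurableT_comp (measurable_indicE _ mA) measurable_fst)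
      (measurable_gexp_sub (2 * c) _ _ _ _ measurable_fst measurable_snd))).
- by move=> x _; rewrite lee_fin indic_gexp_ge0.
- exact: conv_ge0.
congr (_ * _)%E; rewrite convE; apply: eq_integral => x _.
by rewrite gexp_subC.
Qed.

(** * Real-valued heat and integration over the fundamental domain *)

Lemma mass_fin c : 0 < c -> mass c \is a fin_num.
Proof. by move=> c0; have /andP[m0 my] := gexp_int _ c0; rewrite gt0_fin_numE. Qed.

Lemma mass_gt0 c : 0 < c -> 0 < fine (mass c).
Proof. by move=> c0; rewrite fine_gt0// gexp_int. Qed.

Lemma conv_le_mass c A z : measurable A -> (cv c A z <= mass c)%E.
Proof.
move=> mA; rewrite -(conv_setT c z); apply: ge0_subset_integral => //.
- by apply/measurable_EFinP; exact: measurable_gexp_sub.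
- by move=> y _; rewrite lee_fin gexp_ge0.
Qed.

Definition heat c A z : R := fine (cv c A z).

Lemma EFin_heat c A z : 0 < c -> measurable A -> (heat c A z)%:E = cv c A z.
Proof.
move=> c0 mA; rewrite fineK// ge0_fin_numE ?conv_ge0//.
by apply: le_lt_trans (conv_le_mass _ _ _ mA) _; case/andP: (gexp_int _ c0).
Qed.

(** A class closed under sums, products and scaling, and contained in the integrable functions
    because [D] has finite measure; integrability then reduces to closure properties. *)
Definition bounded_mfun (f : T -> R) :=
  measurable_fun setT f /\ exists M, forall x, `|f x| <= M.

Lemma bounded_mfun_heat c A : 0 < c -> measurable A -> bounded_mfun (heat c A).
Proof.
move=> c0 mA; split.
  by apply: (measurableT_comp (fine_measurable measurableT)); exact: measurable_conv.
exists (fine (mass c)) => z.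
rewrite ger0_norm; last exact: fine_ge0 (conv_ge0 _ _ _).
by rewrite -lee_fin (EFin_heat _ _ _ c0 mA) (fineK (mass_fin _ c0)); exact: conv_le_mass.
Qed.

Lemma bounded_mfun_indic A : measurable A -> bounded_mfun \1_A.
Proof.
move=> mA; split; first exact: measurable_indicE.
by exists 1 => x; rewrite indicE ger0_norm// lern1 leq_b1.
Qed.

Lemma bounded_mfunM f g : bounded_mfun f -> bounded_mfun g ->
  bounded_mfun (fun x => f x * g x).
Proof.
move=> [mf [M fM]] [mg [L gL]]; split; first exact: measurable_funM.
by exists (M * L) => x; rewrite normrM ler_pM.
Qed.

Lemma bounded_mfunD f g : bounded_mfun f -> bounded_mfun g ->
  bounded_mfun (fun x => f x + g x).
Proof.
move=> [mf [M fM]] [mg [L gL]]; split; first exact: measurable_funD.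
by exists (M + L) => x; apply: le_trans (ler_normD _ _) _; rewrite lerD.
Qed.

Lemma bounded_mfunZ k f : bounded_mfun f -> bounded_mfun (fun x => k * f x).
Proof.
move=> [mf [M fM]]; split; first exact: measurable_funM.
by exists (`|k| * M) => x; rewrite normrM ler_wpM2l.
Qed.

Lemma bounded_mfun_sum I (r : seq I) (P : pred I) (f : I -> T -> R) :
  (forall i, bounded_mfun (f i)) ->
  bounded_mfun (fun x => \sum_(i <- r | P i) f i x).
Proof.
move=> bf; elim: r => [|i r IH].
  under [X in bounded_mfun X]eq_fun do rewrite big_nil.
  by split=> //; exists 0 => x; rewrite normr0.
under [X in bounded_mfun X]eq_fun do rewrite big_cons.
by case: (P i) => //; exact: bounded_mfunD.
Qed.

(** On [D] the squared norm is at most [b], so [gexp 1] is at least [expR (- b)] there, and an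
    infinite measure of [D] would contradict the finite Gaussian mass. *)
Lemma fund_domain_lty : (mu D < +oo)%E.
Proof.
pose b := \sum_(i < dim) (\sum_(j < dim) `|B i j|) ^+ 2.
have mD := measurable_fund_domain.
have Db x : D x -> nrm x <= b.
  move=> [t [t01 xE]]; rewrite /sqnorm; apply: ler_sum => i _.
  rewrite -[X in X <= _]real_normK ?num_real// lerXn2r ?nnegrE ?sumr_ge0//.
  rewrite xE; apply: le_trans (ler_norm_sum _ _ _) _; apply: ler_sum => j _.
  by rewrite normrM ler_piMr// ger0_norm; have /andP[] := t01 j => // _ /ltW.
have : (\int[mu]_(x in D) (expR (- b))%:E < +oo)%E.
  apply: le_lt_trans (proj2 (andP (gexp_int _ ltr01))).
  apply: (@le_trans _ _ (\int[mu]_(x in D) (gexp 1 x)%:E)%E).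
    apply: ge0_le_integral => //.
    - by apply/measurable_EFinP; exact: (measurable_funTS (measurable_gexp 1)).
    - by move=> x Dx; rewrite lee_fin ler_expR mul1r lerN2 Db.
  apply: ge0_subset_integral => //.
  - by apply/measurable_EFinP; exact: measurable_gexp.
  - by move=> x _; rewrite lee_fin gexp_ge0.
rewrite integral_cst// => bD; rewrite ltey; apply/eqP => Dy; move: bD.
have -> : ((expR (- b))%:E * mu D = +oo)%E.
  by rewrite Dy gt0_muley// lte_fin expR_gt0.
by [].
Qed.

Local Notation I f := (\int[mu]_(x in D) f x).

Lemma bounded_mfun_integrable f : bounded_mfun f -> mu.-integrable D (EFin \o f).
Proof.
move=> [mf [M fM]]; apply: measurable_bounded_integrable.
- exact: measurable_fund_domain.
- exact: fund_domain_lty.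
- exact: measurable_funTS.
- exists M; split; first exact: num_real.
  by move=> x Mx y _; exact: le_trans (fM y) (ltW Mx).
Qed.

Lemma fund_RintegralZ k f : bounded_mfun f -> I (fun x => k * f x) = k * I f.
Proof.
move=> bf; apply: RintegralZl; first exact: measurable_fund_domain.
exact: bounded_mfun_integrable.
Qed.

Lemma fund_RintegralD f g : bounded_mfun f -> bounded_mfun g ->
  I (fun x => f x + g x) = I f + I g.
Proof.
move=> bf bg; apply: RintegralD; first exact: measurable_fund_domain.
all: exact: bounded_mfun_integrable.
Qed.

Lemma fund_Rintegral_sum J (r : seq J) (P : pred J) (f : J -> T -> R) :
  (forall i, bounded_mfun (f i)) ->
  I (fun x => \sum_(i <- r | P i) f i x) = \sum_(i <- r | P i) I (f i).
Proof.
move=> bf; elim: r => [|i r IH].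
  by rewrite big_nil /Rintegral integral0_eq// => x _; rewrite big_nil.
rewrite big_cons; under eq_Rintegral do rewrite big_cons.
case: (P i) => //; rewrite fund_RintegralD// ?IH//; exact: bounded_mfun_sum.
Qed.

Lemma le_fund_Rintegral f g : bounded_mfun f -> bounded_mfun g -> (forall x, f x <= g x) ->
  I f <= I g.
Proof.
move=> bf bg fg; apply: le_Rintegral => //; first exact: measurable_fund_domain.
all: exact: bounded_mfun_integrable.
Qed.

Lemma EFin_fund_Rintegral f : bounded_mfun f -> (\int[mu]_(x in D) (f x)%:E)%E = (I f)%:E.
Proof.
move=> bf; rewrite /Rintegral fineK//.
exact: (integrable_fin_num measurable_fund_domain (bounded_mfun_integrable _ bf)).
Qed.

Local Notation P c A C := (I (fun x => \1_A x * heat c C x)).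

(** Real version of [heat_content]. It exhibits the heat content as a positive multiple of an inner
    product, which gives both its symmetry and its sign properties. *)
Lemma heat_form c A C : 0 < c -> measurable A -> periodic A ->
  measurable C -> periodic C ->
  P c A C = (fine (mass (4 * c)))^-1 *
    I (fun z => heat (2 * c) A z * heat (2 * c) C z).
Proof.
move=> c0 mA pA mC pC.
have c2 : 0 < 2 * c by rewrite mulr_gt0.
have c4 : 0 < 4 * c by rewrite mulr_gt0.
have b1 : bounded_mfun (fun x => \1_A x * heat c C x).
  exact: (bounded_mfunM _ _ (bounded_mfun_indic _ mA) (bounded_mfun_heat _ _ c0 mC)).
have b2 : bounded_mfun (fun z => heat (2 * c) A z * heat (2 * c) C z).
  exact: (bounded_mfunM _ _ (bounded_mfun_heat _ _ c2 mA) (bounded_mfun_heat _ _ c2 mC)).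
suff E : ((P c A C)%:E * (fine (mass (4 * c)))%:E =
    (I (fun z => heat (2 * c) A z * heat (2 * c) C z))%:E)%E.
  move: E; rewrite -EFinM => -[<-].
  by rewrite mulrC mulfK// lt0r_neq0// mass_gt0.
apply: (etrans (congr2 (fun a b => a * b)%E (esym (EFin_fund_Rintegral _ b1))
  (fineK (mass_fin _ c4)))).
apply: etrans (EFin_fund_Rintegral _ b2).
rewrite !(ge0_integral_indic D).
transitivity (\int[mu]_x ((\1_D x)%:E * ((\1_A x)%:E * cv c C x)) * mass (4 * c))%E.
  congr (_ * _)%E; apply: eq_integral => x _; congr (_ * _)%E.
  by rewrite EFinM (EFin_heat _ _ _ c0 mC).
rewrite heat_content//; apply: eq_integral => x _; congr (_ * _)%E.
by rewrite EFinM (EFin_heat _ _ _ c2 mA) (EFin_heat _ _ _ c2 mC).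
Qed.

Lemma heat_form_sym c A C : 0 < c -> measurable A -> periodic A ->
  measurable C -> periodic C -> P c A C = P c C A.
Proof.
move=> c0 mA pA mC pC; apply: (etrans (heat_form _ _ _ c0 mA pA mC pC)).
apply: (etrans _ (esym (heat_form _ _ _ c0 mC pC mA pA))).
by congr (_ * _); apply: eq_Rintegral => z _; rewrite mulrC.
Qed.

(** * Energy of partitions and one step of the scheme *)

Section Partition.
Variable N : nat.
Implicit Types S : 'I_N -> set T.
Local Notation is_partition := (is_partition coord mk B).

Lemma sum_indic_partition S (u : 'I_N -> R) i x : is_partition S -> S i x ->
  \sum_(j < N) \1_(S j) x * u j = u i.
Proof.
move=> [_ [_ uS]] Six; rewrite (bigD1 i)//= indicE mem_set// mul1r big1 ?addr0//.
move=> j ji; rewrite indicE memNset ?mul0r// => Sjx.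
have [k [_ ku]] := uS x.
by move/eqP: ji; apply; rewrite -(ku _ Six) -(ku _ Sjx).
Qed.

(** The indicators of the phases sum to 1, so the value is the same for every partition; differences
    of two partitions therefore have zero sum at each point. *)
Lemma sum_heat_partition S c z : 0 < c -> is_partition S ->
  \sum_(i < N) heat c (S i) z = fine (mass c).
Proof.
move=> c0 pS; have [mS _] := pS.
suff E : (\sum_(i < N) (heat c (S i) z)%:E = mass c)%E.
  by rewrite -E sumEFin.
rewrite -(conv_setT c z).
under eq_bigr do rewrite (EFin_heat _ _ _ c0 (mS _)) convE.
rewrite -ge0_integral_sum//; last 2 first.
- by move=> i; apply/measurable_EFinP;
    exact: (measurable_fun_pair2 z (measurable_conv_integrand _ _ (mS i))).
- by move=> i y _; rewrite lee_fin indic_gexp_ge0.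
apply: eq_integral => y _; have [_ [_ /(_ y)[i [Siy _]]]] := pS.
by rewrite sumEFin (sum_indic_partition _ (fun=> gexp c (z :-: y)) _ _ pS Siy).
Qed.

(** By [heat_form] the sum is a positive multiple of the integral of the form [w] at the vector [h],
    the narrow convolution of the difference of the two partitions. That vector has zero sum at each
    point, so the integrand is nonpositive. *)
Lemma quadratic_part_le0 c (w : 'I_N -> 'I_N -> R) S S' : 0 < c ->
  is_partition S -> is_partition S' ->
  (forall v : 'I_N -> R, \sum_i v i = 0 ->
     \sum_i \sum_(j | j != i) w i j * (v i * v j) <= 0) ->
  \sum_i \sum_(j | j != i) w i j *
    (P c (S' i) (S' j) - P c (S' i) (S j) - P c (S i) (S' j) + P c (S i) (S j)) <= 0.
Proof.
move=> c0 pS pS' wneg.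
have [mS [tS _]] := pS; have [mS' [tS' _]] := pS'.
have c2 : 0 < 2 * c by rewrite mulr_gt0.
have c4 : 0 < 4 * c by rewrite mulr_gt0.
pose h i z := heat (2 * c) (S' i) z + -1 * heat (2 * c) (S i) z.
have bS i : bounded_mfun (heat (2 * c) (S i)) by exact: bounded_mfun_heat.
have bS' i : bounded_mfun (heat (2 * c) (S' i)) by exact: bounded_mfun_heat.
have bh i : bounded_mfun (h i).
  exact: (bounded_mfunD _ _ (bS' i) (bounded_mfunZ _ _ (bS i))).
have bhh i j : bounded_mfun (fun z => w i j * (h i z * h j z)).
  exact: (bounded_mfunZ _ _ (bounded_mfunM _ _ (bh i) (bh j))).
have -> : \sum_i \sum_(j | j != i) w i j *
    (P c (S' i) (S' j) - P c (S' i) (S j) - P c (S i) (S' j) + P c (S i) (S j)) =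
    (fine (mass (4 * c)))^-1 *
    I (fun z => \sum_i \sum_(j | j != i) w i j * (h i z * h j z)).
  rewrite fund_Rintegral_sum => [|i]; last by apply: bounded_mfun_sum => j; exact: bhh.
  rewrite mulr_sumr; apply: eq_bigr => i _.
  rewrite fund_Rintegral_sum => [|j]; last exact: bhh.
  rewrite mulr_sumr; apply: eq_bigr => j _.
  have tS1 l : periodic (S l) by exact: tS.
  have tS1' l : periodic (S' l) by exact: tS'.
  pose k := (fine (mass (4 * c)))^-1.
  pose q A C := I (fun z => heat (2 * c) A z * heat (2 * c) C z).
  transitivity (w i j * (k * q (S' i) (S' j) - k * q (S' i) (S j)
      - k * q (S i) (S' j) + k * q (S i) (S j))).
    by congr (_ * (_ - _ - _ + _)); apply: heat_form.
  rewrite -!mulrBr -mulrDr mulrCA; congr (_ * _).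
  apply: etrans (esym (fund_RintegralZ (w i j) _ (bounded_mfunM _ _ (bh i) (bh j)))).
  congr (_ * _); rewrite /q.
  have bM f g : bounded_mfun f -> bounded_mfun g ->
      bounded_mfun (fun z => f z * g z) by exact: bounded_mfunM.
  transitivity (I (fun z => heat (2 * c) (S' i) z * heat (2 * c) (S' j) z
      + -1 * (heat (2 * c) (S' i) z * heat (2 * c) (S j) z)
      + -1 * (heat (2 * c) (S i) z * heat (2 * c) (S' j) z)
      + heat (2 * c) (S i) z * heat (2 * c) (S j) z)).
    have b0 A C : bounded_mfun (heat (2 * c) A) -> bounded_mfun (heat (2 * c) C) ->
        bounded_mfun (fun z => -1 * (heat (2 * c) A z * heat (2 * c) C z)).
      by move=> bA bC; apply: bounded_mfunZ; exact: bM.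
    rewrite fund_RintegralD; [|by do 2?apply: bounded_mfunD; auto|by auto].
    rewrite fund_RintegralD; [|by apply: bounded_mfunD; auto|by auto].
    rewrite fund_RintegralD; [|by auto|by auto].
    by rewrite !(fund_RintegralZ (-1)) ?mulN1r//; auto.
  by apply: eq_Rintegral => z _; rewrite /h; ring.
rewrite mulr_ge0_le0 ?invr_ge0 ?(ltW (mass_gt0 _ c4))//.
apply: (@le_trans _ _ (I (fun=> 0))); last by rewrite /Rintegral integral0_eq.
apply: le_fund_Rintegral.
- by apply: bounded_mfun_sum => i; apply: bounded_mfun_sum => j; exact: bhh.
- by split=> //; exists 0 => x; rewrite normr0.
- move=> z; apply: (wneg (h ^~ z)); rewrite /h big_split /= -mulr_sumr.
  by rewrite !sum_heat_partition// mulN1r addrN.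
Qed.

Variables (sigma mob : 'I_N -> 'I_N -> R) (alpha beta dt : R).
Hypotheses (alpha_gt0 : 0 < alpha) (beta_gt0 : 0 < beta) (dt_gt0 : 0 < dt).

Local Notation a := (acoef sigma mob alpha beta).
Local Notation b := (bcoef sigma mob alpha beta).

Hypothesis acoefC : forall i j, i != j -> a i j = a j i.
Hypothesis bcoefC : forall i j, i != j -> b i j = b j i.
Hypothesis acoef_neg : forall v : 'I_N -> R, \sum_i v i = 0 ->
  \sum_i \sum_(j | j != i) a i j * (v i * v j) <= 0.
Hypothesis bcoef_neg : forall v : 'I_N -> R, \sum_i v i = 0 ->
  \sum_i \sum_(j | j != i) b i j * (v i * v j) <= 0.

Definition gconst (g : R) : R := (4 * pi * g) `^ (- (dim%:R / 2)).
Definition gexpo (g : R) : R := (4 * g)^-1.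

Lemma gexpo_gt0 g : 0 < g -> 0 < gexpo g.
Proof. by move=> g0; rewrite invr_gt0 mulr_gt0. Qed.

Lemma gconst_ge0 g : 0 <= gconst g. Proof. exact: powR_ge0. Qed.

Lemma gaussE g x : gauss coord g x = gconst g * gexp (gexpo g) x.
Proof. by rewrite /gauss /gexp mulNr (mulrC (nrm x)). Qed.

(** Reconciles the energy, whose kernels are rescaled by [sqrt dt], with the algorithm, whose
    Gaussians have parameter [g * dt]: the factor [sqrt dt ^- dim] enters the normalization and
    [1 / dt] the exponent. *)
Lemma rescale_gauss g x : 0 < g ->
  Num.sqrt dt ^- dim * gauss coord g (vscale coord mk (Num.sqrt dt)^-1 x) =
  gauss coord (g * dt) x.
Proof.
move=> g0; have s0 : 0 < Num.sqrt dt by rewrite sqrtr_gt0.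
rewrite /gauss mulrA; congr (_ * expR _).
  rewrite mulrA (@powRM _ _ dt) ?(ltW dt_gt0) ?mulr_ge0 ?pi_ge0 ?(ltW g0)// mulrC.
  congr (_ * _); rewrite powRN; congr (_^-1).
  by rewrite mulrC powRrM powR12_sqrt ?(ltW dt_gt0)// powR_mulrn// sqrtr_ge0.
have -> : nrm x = dt * nrm (vscale coord mk (Num.sqrt dt)^-1 x).
  rewrite /sqnorm mulr_sumr; apply: eq_bigr => i _; rewrite mkK exprMn exprVn.
  by rewrite sqr_sqrtr ?(ltW dt_gt0)// mulVKf// lt0r_neq0.
by field; rewrite (lt0r_neq0 g0) (lt0r_neq0 dt_gt0).
Qed.

Lemma conv_gauss g A x : 0 < g -> measurable A ->
  Defs.conv mu coord mk (gauss coord g) A x =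
  (gconst g * heat (gexpo g) A x)%:E.
Proof.
move=> g0 mA; rewrite EFinM (EFin_heat _ _ _ (gexpo_gt0 _ g0) mA).
transitivity (\int[mu]_(y in A) ((gconst g)%:E * (gexp (gexpo g) (x :-: y))%:E))%E.
  by apply: eq_integral => y _; rewrite gaussE EFinM.
apply: (@ge0_integralZl _ _ _ mu _ mA (fun y => (gexp (gexpo g) (x :-: y))%:E)).
- apply: measurable_funTS; apply/measurable_EFinP; exact: measurable_gexp_sub.
- by move=> y _; rewrite lee_fin gexp_ge0.
- by rewrite lee_fin gconst_ge0.
Qed.

Lemma integrable_gexp c A x : 0 < c -> measurable A ->
  mu.-integrable A (fun y => (gexp c (x :-: y))%:E).
Proof.
move=> c0 mA; apply/integrableP; split.
  apply: measurable_funTS; apply/measurable_EFinP; exact: measurable_gexp_sub.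
have -> : (\int[mu]_(y in A) `|(gexp c (x :-: y))%:E| = cv c A x)%E.
  by apply: eq_integral => y _; rewrite gee0_abs// lee_fin gexp_ge0.
apply: (@le_lt_trans _ _ (mass c)); first exact: conv_le_mass.
by case/andP: (gexp_int _ c0).
Qed.

Definition step_kernel i j A x : R :=
  a i j * (gconst (alpha * dt) * heat (gexpo (alpha * dt)) A x) +
  b i j * (gconst (beta * dt) * heat (gexpo (beta * dt)) A x).

Local Notation ca := (gexpo (alpha * dt)).
Local Notation cb := (gexpo (beta * dt)).
Local Notation ka := (gconst (alpha * dt)).
Local Notation kb := (gconst (beta * dt)).

Lemma ca_gt0 : 0 < ca. Proof. by rewrite gexpo_gt0// mulr_gt0. Qed.
Lemma cb_gt0 : 0 < cb. Proof. by rewrite gexpo_gt0// mulr_gt0. Qed.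

(** The coefficients carry no sign in this section, so the integral is split through integrability
    of each Gaussian and not through nonnegativity. *)
Lemma conv_kernel i j A x : measurable A ->
  Defs.conv mu coord mk (rescale coord mk (Num.sqrt dt)
    (Defs.kernel coord sigma mob alpha beta i j)) A x =
  (step_kernel i j A x)%:E.
Proof.
move=> mA.
transitivity (\int[mu]_(y in A) ((a i j * ka)%:E * (gexp ca (x :-: y))%:E +
    (b i j * kb)%:E * (gexp cb (x :-: y))%:E))%E.
  apply: eq_integral => y _; rewrite -!EFinM -EFinD; congr _%:E.
  rewrite /rescale /Defs.kernel mulrDr (mulrCA _ (a i j)) (mulrCA _ (b i j)).
  rewrite (rescale_gauss _ _ alpha_gt0) (rescale_gauss _ _ beta_gt0).
  by rewrite !gaussE !mulrA.
have ia := integrable_gexp _ _ x ca_gt0 mA.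
have ib := integrable_gexp _ _ x cb_gt0 mA.
rewrite integralD//; [|exact: integrableZl|exact: integrableZl].
rewrite (integralZl mA ia) (integralZl mA ib).
rewrite /step_kernel EFinD !mulrA (EFinM (a i j * ka)) (EFinM (b i j * kb)).
by rewrite (EFin_heat _ _ _ ca_gt0 mA) (EFin_heat _ _ _ cb_gt0 mA).
Qed.

Lemma bounded_mfun_step_kernel i j A : measurable A ->
  bounded_mfun (step_kernel i j A).
Proof.
move=> mA; apply: bounded_mfunD; apply: bounded_mfunZ; apply: bounded_mfunZ.
  exact: bounded_mfun_heat ca_gt0 mA.
exact: bounded_mfun_heat cb_gt0 mA.
Qed.

Definition step_form i j A C : R := a i j * (ka * P ca A C) + b i j * (kb * P cb A C).

Lemma Rintegral_step_kernel i j A C : measurable A -> measurable C ->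
  I (fun x => \1_A x * step_kernel i j C x) = step_form i j A C.
Proof.
move=> mA mC.
have ba := bounded_mfunM _ _ (bounded_mfun_indic _ mA) (bounded_mfun_heat _ _ ca_gt0 mC).
have bb := bounded_mfunM _ _ (bounded_mfun_indic _ mA) (bounded_mfun_heat _ _ cb_gt0 mC).
transitivity (I (fun x => a i j * (ka * (\1_A x * heat ca C x)) +
   b i j * (kb * (\1_A x * heat cb C x)))).
  by apply: eq_Rintegral => x _; rewrite /step_kernel; ring.
have bka := bounded_mfunZ ka _ ba.
have bkb := bounded_mfunZ kb _ bb.
apply: (etrans (fund_RintegralD _ _ (bounded_mfunZ _ _ bka) (bounded_mfunZ _ _ bkb))).
congr (_ + _).
- apply: (etrans (fund_RintegralZ _ _ bka)); congr (_ * _); exact: fund_RintegralZ.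
- apply: (etrans (fund_RintegralZ _ _ bkb)); congr (_ * _); exact: fund_RintegralZ.
Qed.

Lemma energyE S : is_partition S ->
  energy mu coord mk sigma mob alpha beta B dt S =
  ((Num.sqrt dt)^-1 *
    \sum_i \sum_(j | j != i) step_form i j (S j) (S i))%:E.
Proof.
move=> pS; have [mS _] := pS.
rewrite /energy EFinM -sumEFin; congr (_ * _)%E; apply: eq_bigr => i _.
rewrite -sumEFin; apply: eq_bigr => j _.
rewrite -(Rintegral_step_kernel _ _ _ _ (mS j) (mS i)).
have bk := bounded_mfun_step_kernel i j _ (mS i).
apply: etrans (EFin_fund_Rintegral _ (bounded_mfunM _ _ (bounded_mfun_indic _ (mS j)) bk)).
rewrite (ge0_integral_indic (D `&` S j)) (ge0_integral_indic D).
apply: eq_integral => x _; rewrite (conv_kernel _ _ _ _ (mS i)) -!EFinM.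
by rewrite indicI mulrA.
Qed.

Lemma psiE S i x : is_partition S ->
  psi mu coord mk sigma mob alpha beta dt S i x =
  \sum_(j | j != i) step_kernel i j (S j) x.
Proof.
move=> [mS _]; apply: eq_bigr => j _.
by rewrite !conv_gauss// mulr_gt0.
Qed.

Local Notation form S S' := (\sum_i \sum_(j | j != i) step_form i j (S i) (S' j)).

Lemma step_formC i j A C : measurable A -> periodic A ->
  measurable C -> periodic C -> step_form i j A C = step_form i j C A.
Proof.
move=> mA pA mC pC.
exact: (congr2 (fun x y => a i j * (ka * x) + b i j * (kb * y))
  (heat_form_sym _ _ _ ca_gt0 mA pA mC pC)
  (heat_form_sym _ _ _ cb_gt0 mA pA mC pC)).
Qed.

Lemma step_form_swap i j A C : i != j -> step_form i j A C = step_form j i A C.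
Proof. by move=> ij; rewrite /step_form (acoefC _ _ ij) (bcoefC _ _ ij). Qed.

(** Exchanging the sums swaps the indices of the weight, which is symmetric off the diagonal; the
    heat content is symmetric in its two sets. *)
Lemma formC S S' : is_partition S -> is_partition S' -> form S S' = form S' S.
Proof.
move=> [mS [tS _]] [mS' [tS' _]].
transitivity (\sum_j \sum_(i | j != i) step_form i j (S i) (S' j)).
  by apply: exchange_big_dep => i j _ _.
apply: eq_bigr => j _; apply: eq_big => [i|i ji]; first by rewrite eq_sym.
apply: (etrans (step_form_swap _ _ _ _ _)); first by rewrite eq_sym.
exact: step_formC (mS i) (tS i) (mS' j) (tS' j).
Qed.

(** In the energy the convolved set carries the first index; the symmetry of the heat content brings
    the sets into the order used by the linearization. *)
Lemma energy_form S : is_partition S ->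
  energy mu coord mk sigma mob alpha beta B dt S =
  ((Num.sqrt dt)^-1 * form S S)%:E.
Proof.
move=> pS; rewrite (energyE _ pS); have [mS [tS _]] := pS.
congr (_ * _)%:E; apply: eq_bigr => i _; apply: eq_bigr => j _.
exact: step_formC (mS j) (tS j) (mS i) (tS i).
Qed.

(** For a partition [V], [form V S] is the integral over [D] of [psi] taken at the index of the
    phase of [V] containing the point. The new partition picks a minimizing index everywhere,
    however ties are broken. *)
Lemma form_le_minimizer S S' : is_partition S ->
  alg4_step mu coord mk sigma mob alpha beta B dt S S' -> form S' S <= form S S.
Proof.
move=> pS [pS' min'].
have [mS _] := pS; have [mS' _] := pS'.
pose ps i x := \sum_(j | j != i) step_kernel i j (S j) x.
have bps i : bounded_mfun (ps i).
  by apply: bounded_mfun_sum => j; exact: bounded_mfun_step_kernel.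
have bV (V : 'I_N -> set T) i : is_partition V -> bounded_mfun (fun x => \1_(V i) x * ps i x).
  by move=> [mV _]; exact: (bounded_mfunM _ _ (bounded_mfun_indic _ (mV i)) (bps i)).
have formE V : is_partition V -> form V S = I (fun x => \sum_i \1_(V i) x * ps i x).
  move=> pV; have [mV _] := pV; rewrite fund_Rintegral_sum => [|i]; last exact: bV.
  apply: eq_bigr => i _.
  transitivity (I (fun x => \sum_(j | j != i) \1_(V i) x * step_kernel i j (S j) x)).
    rewrite fund_Rintegral_sum => [|j].
      by apply: eq_bigr => j _; rewrite Rintegral_step_kernel.
    exact: (bounded_mfunM _ _ (bounded_mfun_indic _ (mV i))
      (bounded_mfun_step_kernel i j _ (mS j))).
  by apply: eq_Rintegral => x _; rewrite /ps mulr_sumr.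
rewrite (formE _ pS) (formE _ pS'); apply: le_fund_Rintegral.
- by apply: bounded_mfun_sum => i; exact: bV.
- by apply: bounded_mfun_sum => i; exact: bV.
- move=> x; have [_ [_ /(_ x)[i [Six _]]]] := pS.
  have [_ [_ /(_ x)[i' [Si'x _]]]] := pS'.
  rewrite (sum_indic_partition _ (fun i => ps i x) _ _ pS Six).
  rewrite (sum_indic_partition _ (fun i => ps i x) _ _ pS' Si'x).
  by have := min' _ _ Si'x i; rewrite !psiE.
Qed.

(** Stated for arbitrary functions so that the termwise algebra never meets the integrals hidden in
    [step_form]. *)
Lemma sum_second_difference (w1 w2 : 'I_N -> 'I_N -> R) (k1 k2 : R)
    (x1 x2 x3 x4 y1 y2 y3 y4 : 'I_N -> 'I_N -> R) :
  \sum_i \sum_(j | j != i) (w1 i j * (k1 * x1 i j) + w2 i j * (k2 * y1 i j)) -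
  \sum_i \sum_(j | j != i) (w1 i j * (k1 * x2 i j) + w2 i j * (k2 * y2 i j)) -
  \sum_i \sum_(j | j != i) (w1 i j * (k1 * x3 i j) + w2 i j * (k2 * y3 i j)) +
  \sum_i \sum_(j | j != i) (w1 i j * (k1 * x4 i j) + w2 i j * (k2 * y4 i j)) =
  k1 * (\sum_i \sum_(j | j != i)
    w1 i j * (x1 i j - x2 i j - x3 i j + x4 i j)) +
  k2 * (\sum_i \sum_(j | j != i)
    w2 i j * (y1 i j - y2 i j - y3 i j + y4 i j)).
Proof.
rewrite !mulr_sumr -!sumrN -!big_split /=; apply: eq_bigr => i _.
rewrite !mulr_sumr -!sumrN -!big_split /=; apply: eq_bigr => j _.
by ring.
Qed.

(** The left side is the form evaluated at the difference of the two partitions, so the inequality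
    expresses concavity of the energy along zero-sum directions. *)
Lemma form_convex S S' : is_partition S -> is_partition S' ->
  form S' S' - form S' S - form S S' + form S S <= 0.
Proof.
move=> pS pS'.
have qa := quadratic_part_le0 _ _ _ _ ca_gt0 pS pS' acoef_neg.
have qb := quadratic_part_le0 _ _ _ _ cb_gt0 pS pS' bcoef_neg.
have q := lerD (mulr_ge0_le0 (gconst_ge0 (alpha * dt)) qa)
  (mulr_ge0_le0 (gconst_ge0 (beta * dt)) qb).
rewrite addr0 in q; apply: etrans q; congr (_ <= _).
exact: (sum_second_difference a b ka kb
  (fun i j => P ca (S' i) (S' j)) (fun i j => P ca (S' i) (S j))
  (fun i j => P ca (S i) (S' j)) (fun i j => P ca (S i) (S j))
  (fun i j => P cb (S' i) (S' j)) (fun i j => P cb (S' i) (S j))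
  (fun i j => P cb (S i) (S' j)) (fun i j => P cb (S i) (S j))).
Qed.

Lemma gradient_stable_step S S' : is_partition S ->
  alg4_step mu coord mk sigma mob alpha beta B dt S S' ->
  (energy mu coord mk sigma mob alpha beta B dt S' <=
   energy mu coord mk sigma mob alpha beta B dt S)%E.
Proof.
move=> pS SS'; have [pS' _] := SS'.
rewrite (energy_form _ pS) (energy_form _ pS') lee_fin.
apply: ler_wpM2l; first by rewrite invr_ge0 sqrtr_ge0.
(* [e11 <= e10 + e01 - e00 = 2 * e10 - e00 <= e00]. *)
have aux (e11 e10 e01 e00 : R) : e11 - e10 - e01 + e00 <= 0 ->
    e01 = e10 -> e10 <= e00 -> e11 <= e00 by lra.
exact: aux (form_convex _ _ pS pS') (formC _ _ pS pS')
  (form_le_minimizer _ _ pS SS').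
Qed.

Lemma gradient_stable_of_forms :
  gradient_stable mu coord mk sigma mob alpha beta B dt.
Proof.
move=> Sig pS0 st k; apply: gradient_stable_step => //.
by case: k => [//|k]; case: (st k).
Qed.

End Partition.
End Periodic.

Arguments gexp {R dT T dim}.

(** * Lebesgue measure in two and three dimensions *)

Section Lebesgue.
Variable R : realType.
Local Notation leb := (@lebesgue_measure R).

Lemma measurable_shift (l : R) :
  measurable_fun setT (fun x : measurableTypeR R => x + l : measurableTypeR R).
Proof. exact: measurable_funD. Qed.

(** The pushforward of Lebesgue measure by the shift has the right value on half-open intervals,
    hence equals Lebesgue measure by uniqueness. *)
Lemma ge0_integral_lebesgue_shift (F : measurableTypeR R -> \bar R) (l : R) :
  measurable_fun setT F -> (forall x, 0 <= F x)%E ->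
  (\int[leb]_x F (x + l)%R = \int[leb]_x F x)%E.
Proof.
move=> mF F0.
rewrite -(ge0_integral_pushforward (measurable_shift l) leb measurableT)//.
apply: eq_measure_integral; first exact: measurable_shift.
move=> mshift A mA _; apply: esym.
apply: lebesgue_measure_unique => // _ [[x y] _ <-] /=.
rewrite /pushforward.
have -> : (fun z : measurableTypeR R => z + l) @^-1` `]x, y] = `]x - l, y - l]%classic.
  by apply/seteqP; split => z /=; rewrite !in_itv /= ltrBlDr lerBrDr.
rewrite !lebesgue_measure_itv /= !lte_fin ltrD2r.
by case: ifP => // _; rewrite -!EFinB; congr _%:E; ring.
Qed.

Lemma measurable_expNsqr (c : R) :
  measurable_fun setT (fun x : measurableTypeR R => expR (- (c * x ^+ 2))).
Proof.
apply: measurableT_comp => //; apply: measurableT_comp => //.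
by apply: measurable_funM => //; exact: measurable_funX.
Qed.

Lemma lebesgue_gauss (c : R) : 0 < c ->
  (0 < \int[leb]_x (expR (- (c * x ^+ 2)))%:E < +oo)%E.
Proof.
(* With variance [(2 * c)^-1] the normal density is a positive constant times the integrand. Its
   integral is 1, which rules out the values zero and infinity. *)
move=> c0; pose s := Num.sqrt (2 * c)^-1.
have c2 : 0 < (2 * c)^-1 by rewrite invr_gt0 mulr_gt0.
have s0 : s != 0 by rewrite lt0r_neq0// sqrtr_gt0.
have p0 := normal_peak_gt0 s0.
have := integral_normal_pdf 0 s; rewrite normal_pdfE//= => i1.
have : (\int[leb]_x ((normal_peak s)%:E * (expR (- (c * x ^+ 2)))%:E) = 1)%E.
  rewrite -[RHS]i1; apply: eq_integral => x _; rewrite -EFinM; congr (_ * expR _)%:E.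
  rewrite subr0 sqr_sqrtr ?(ltW c2)// -mulr_natr.
  by field; rewrite lt0r_neq0.
rewrite (@ge0_integralZl _ _ _ leb _ measurableT
  (fun x => (expR (- (c * x ^+ 2)))%:E)); last 3 first.
- by apply/measurable_EFinP; exact: measurable_expNsqr.
- by move=> x _; rewrite lee_fin expR_ge0.
- by rewrite lee_fin ltW.
have : (0 <= \int[leb]_x (expR (- (c * x ^+ 2)))%:E)%E.
  by apply: integral_ge0 => x _; rewrite lee_fin expR_ge0.
case: (\int[leb]_x _)%E => [r| |] //=.
  rewrite lee_fin -EFinM le0r => /orP[/eqP ->|r0 _].
    by rewrite mulr0 => -[] /esym/eqP; rewrite oner_eq0.
  by rewrite lte_fin r0 ltry.
by move=> _; rewrite gt0_muley ?lte_fin.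
Qed.

End Lebesgue.

Section Product.
Variables (R : realType) (d1 d2 : measure_display).
Variables (T1 : measurableType d1) (T2 : measurableType d2).
Variables (m1 : {sigma_finite_measure set T1 -> \bar R}).
Variables (m2 : {sigma_finite_measure set T2 -> \bar R}).

(** Maps that preserve the integral in each factor preserve it on the product, by Tonelli. Applied
    to translations, twice in succession for three-space. *)
Lemma ge0_integral_prod_comp (p1 : T1 -> T1) (p2 : T2 -> T2) F :
  measurable_fun setT p1 -> measurable_fun setT p2 ->
  (forall G, measurable_fun setT G -> (forall x, 0 <= G x)%E ->
    \int[m1]_x G (p1 x) = \int[m1]_x G x)%E ->
  (forall G, measurable_fun setT G -> (forall x, 0 <= G x)%E ->
    \int[m2]_x G (p2 x) = \int[m2]_x G x)%E ->
  measurable_fun setT F -> (forall x, 0 <= F x)%E ->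
  (\int[m1 \x m2]_x F (p1 x.1, p2 x.2) = \int[m1 \x m2]_x F x)%E.
Proof.
move=> mp1 mp2 i1 i2 mF F0.
rewrite fubini_tonelli1//; last first.
  apply: (measurableT_comp mF); apply: measurable_fun_pair.
    exact: (measurableT_comp mp1 measurable_fst).
  exact: (measurableT_comp mp2 measurable_snd).
rewrite fubini_tonelli1//; apply: (etrans _ (i1 _ _ _)); last 2 first.
- exact: measurable_fun_fubini_tonelli_F.
- by move=> x; exact: integral_ge0.
apply: eq_integral => x _; rewrite /fubini_F /=.
by apply: (i2 (fun y => F (p1 x, y))) => //; exact: (measurable_fun_pair2 (p1 x) mF).
Qed.

Lemma ge0_integral_prod_split (f : T1 -> R) (g : T2 -> R) :
  measurable_fun setT f -> measurable_fun setT g ->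
  (forall x, 0 <= f x) -> (forall x, 0 <= g x) ->
  (\int[m1 \x m2]_x (f x.1 * g x.2)%:E =
   \int[m1]_x (f x)%:E * \int[m2]_x (g x)%:E)%E.
Proof.
move=> mf mg f0 g0.
rewrite fubini_tonelli1//; last 2 first.
- apply/measurable_EFinP; apply: measurable_funM.
    exact: (measurableT_comp mf measurable_fst).
  exact: (measurableT_comp mg measurable_snd).
- by move=> x; rewrite lee_fin mulr_ge0.
rewrite -(@ge0_integralZr _ _ _ m1 _ measurableT (EFin \o f)); last 3 first.
- exact/measurable_EFinP.
- by move=> x _; rewrite lee_fin.
- by apply: integral_ge0 => x _; rewrite lee_fin.
apply: eq_integral => x _; rewrite /fubini_F /=.
rewrite -(@ge0_integralZl _ _ _ m2 _ measurableT (EFin \o g))//.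
- exact/measurable_EFinP.
- by move=> y _; rewrite lee_fin.
- by rewrite lee_fin.
Qed.

Lemma ge0_integral_prod_split_bounds (f : T1 -> R) (g : T2 -> R) :
  measurable_fun setT f -> measurable_fun setT g ->
  (forall x, 0 <= f x) -> (forall x, 0 <= g x) ->
  (0 < \int[m1]_x (f x)%:E < +oo)%E -> (0 < \int[m2]_x (g x)%:E < +oo)%E ->
  (0 < \int[m1 \x m2]_x (f x.1 * g x.2)%:E < +oo)%E.
Proof.
move=> mf mg f0 g0 /andP[i0 iy] /andP[j0 jy].
by rewrite ge0_integral_prod_split// mule_gt0//= lte_mul_pinfty ?(ltW i0)// gt0_fin_numE.
Qed.
End Product.

Section SigmaFiniteProduct.
Variables (R : realType) (d1 d2 : measure_display).
Variables (T1 : measurableType d1) (T2 : measurableType d2).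
Variables (m1 : {sigma_finite_measure set T1 -> \bar R}).
Variables (m2 : {sigma_finite_measure set T2 -> \bar R}).

(* The library declares [\x] canonically sigma-finite only for products of
   probabilities; this alias carries the structure in general. *)
Definition sigma_finite_prod := (m1 \x m2)%E.

HB.instance Definition _ := Measure.on sigma_finite_prod.

Let sigma_finite_prodT : sigma_finite setT sigma_finite_prod.
Proof.
have [F FT Foo] := sigma_finiteT m1; have [G GT Goo] := sigma_finiteT m2.
(* The rectangles [F i] times [G j], enumerated by a coding of pairs, cover the product and have
   finite measure. *)
exists (fun n => if choice.unpickle n is Some (i, j) then F i `*` G j else set0).
  apply/seteqP; split => // -[x y] _.
  have [i _ Fx] : (\bigcup_i F i) x by rewrite -FT.
  have [j _ Gy] : (\bigcup_j G j) y by rewrite -GT.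
  by exists (choice.pickle (i, j)) => //=; rewrite choice.pickleK.
move=> n; case: choice.unpickle => [[i j]|]; last by rewrite measure0.
have [mF Fy] := Foo i; have [mG Gy] := Goo j; split; first exact: measurableX.
rewrite /sigma_finite_prod product_measure1E//.
by rewrite lte_mul_pinfty// ge0_fin_numE.
Qed.

HB.instance Definition _ := Measure_isSigmaFinite.Build _ _ _ sigma_finite_prod
  sigma_finite_prodT.
End SigmaFiniteProduct.

Section Coordinates.
Variable R : realType.
Local Notation leb := (@lebesgue_measure R).
Local Notation sleb2 := (@sigma_finite_prod R _ _ _ _ leb leb).
Local Notation sleb3 := (@sigma_finite_prod R _ _ _ _ sleb2 leb).

Lemma mk2K (c : 'I_2 -> R) i : coord2 (mk2 c) i = c i.
Proof.
by case: i => [[|[|//]]] i; rewrite /coord2 /=; congr c; apply/val_inj;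
  rewrite /= inordK.
Qed.

Lemma mk3K (c : 'I_3 -> R) i : coord3 (mk3 c) i = c i.
Proof.
by case: i => [[|[|[|//]]]] i; rewrite /coord3 /=; congr c; apply/val_inj;
  rewrite /= inordK.
Qed.

Lemma coord2_inj (x y : pt2 R) : (forall i, coord2 x i = coord2 y i) -> x = y.
Proof.
case: x y => [x1 x2] [y1 y2] e.
by move: (e ord0) (e ord_max); rewrite /coord2 /= => -> ->.
Qed.

Lemma coord3_inj (x y : pt3 R) : (forall i, coord3 x i = coord3 y i) -> x = y.
Proof.
case: x y => [[x1 x2] x3] [[y1 y2] y3] e.
move: (e ord0) (e (Ordinal (isT : (1 < 3)%N))) (e ord_max).
by rewrite /coord3 /= => -> -> ->.
Qed.

Lemma measurable_coord2 i : measurable_fun setT (fun x : pt2 R => coord2 x i).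
Proof.
case: i => [[|[|//]]] i; rewrite /coord2 /=.
  exact: measurable_fst.
exact: measurable_snd.
Qed.

Lemma measurable_coord3 i : measurable_fun setT (fun x : pt3 R => coord3 x i).
Proof.
case: i => [[|[|[|//]]]] i; rewrite /coord3 /=.
- exact: (measurableT_comp measurable_fst measurable_fst).
- exact: (measurableT_comp measurable_snd measurable_fst).
- exact: measurable_snd.
Qed.

Lemma measurable_mk2 d (S : measurableType d) (c : S -> 'I_2 -> R) :
  (forall i, measurable_fun setT (fun s => c s i)) ->
  measurable_fun setT (fun s => mk2 (c s) : pt2 R).
Proof. by move=> mc; apply: measurable_fun_pair; exact: mc. Qed.

Lemma measurable_mk3 d (S : measurableType d) (c : S -> 'I_3 -> R) :
  (forall i, measurable_fun setT (fun s => c s i)) ->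
  measurable_fun setT (fun s => mk3 (c s) : pt3 R).
Proof.
move=> mc; apply: measurable_fun_pair; last exact: mc.
by apply: measurable_fun_pair; exact: mc.
Qed.

Lemma ge0_integral_shift2 (F : pt2 R -> \bar R) (l : pt2 R) :
  measurable_fun setT F -> (forall x, 0 <= F x)%E ->
  (\int[@leb2 R]_x F (vadd (@coord2 R) (@mk2 R) x l) = \int[@leb2 R]_x F x)%E.
Proof.
move=> mF F0.
transitivity (\int[@leb2 R]_x F (x.1 + l.1, x.2 + l.2)%R)%E.
  apply: eq_integral => x _; congr F.
  by apply: coord2_inj => -[[|[|//]]] i; rewrite mk2K.
apply: (@ge0_integral_prod_comp _ _ _ _ _ leb leb
  (fun x => x + l.1) (fun x => x + l.2) F).
all: try exact: measurable_shift.
- by move=> G mG G0; exact: ge0_integral_lebesgue_shift.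
- by move=> G mG G0; exact: ge0_integral_lebesgue_shift.
- by [].
- by [].
Qed.

Lemma ge0_integral_shift3 (F : pt3 R -> \bar R) (l : pt3 R) :
  measurable_fun setT F -> (forall x, 0 <= F x)%E ->
  (\int[@leb3 R]_x F (vadd (@coord3 R) (@mk3 R) x l) = \int[@leb3 R]_x F x)%E.
Proof.
move=> mF F0.
transitivity (\int[@leb3 R]_x F (vadd (@coord2 R) (@mk2 R) x.1 l.1, x.2 + l.2)%R)%E.
  apply: eq_integral => x _; congr F.
  have inordE k (k2 : (k < 2)%N) : @inord 1 k = Ordinal k2.
    by apply/val_inj; rewrite /= inordK.
  apply: coord3_inj => -[[|[|[|//]]]] i; rewrite mk3K /coord3 //=.
    by rewrite (inordE 0%N isT).
  by rewrite (inordE 1%N isT).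
apply: (@ge0_integral_prod_comp _ _ _ _ _ sleb2 leb
  (fun x => vadd (@coord2 R) (@mk2 R) x l.1) (fun x => x + l.2) F).
- apply: measurable_mk2 => i; apply: measurable_funD => //.
  exact: measurable_coord2.
- exact: measurable_shift.
- by move=> G mG G0; exact: ge0_integral_shift2.
- by move=> G mG G0; exact: ge0_integral_lebesgue_shift.
- by [].
- by [].
Qed.

Lemma gexp2E c (x : pt2 R) :
  gexp (@coord2 R) c x = expR (- (c * x.1 ^+ 2)) * expR (- (c * x.2 ^+ 2)).
Proof.
rewrite /gexp /sqnorm big_ord_recl big_ord1 -expRD; congr expR.
by rewrite mulrDr opprD.
Qed.

Lemma gexp3E c (x : pt3 R) :
  gexp (@coord3 R) c x = gexp (@coord2 R) c x.1 * expR (- (c * x.2 ^+ 2)).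
Proof.
rewrite /gexp /sqnorm !big_ord_recl !big_ord0 -expRD; congr expR.
by rewrite /coord3 /coord2 /=; ring.
Qed.

Lemma gexp2_int (c : R) : 0 < c ->
  (0 < \int[@leb2 R]_x (gexp (@coord2 R) c x)%:E < +oo)%E.
Proof.
move=> c0; under eq_integral do rewrite gexp2E.
apply: (@ge0_integral_prod_split_bounds _ _ _ _ _ leb leb
  (fun x => expR (- (c * x ^+ 2))) (fun x => expR (- (c * x ^+ 2)))
  (measurable_expNsqr _ c) (measurable_expNsqr _ c)) => //.
all: try by move=> x; exact: expR_ge0.
all: exact: lebesgue_gauss.
Qed.

Lemma gexp3_int (c : R) : 0 < c ->
  (0 < \int[@leb3 R]_x (gexp (@coord3 R) c x)%:E < +oo)%E.
Proof.
move=> c0; under eq_integral do rewrite gexp3E.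
apply: (@ge0_integral_prod_split_bounds _ _ _ _ _ sleb2 leb
  (gexp (@coord2 R) c) (fun x => expR (- (c * x ^+ 2)))
  (measurable_gexp _ _ _ _ _ measurable_coord2 _) (measurable_expNsqr _ c)) => //.
- by move=> x; exact: expR_ge0.
- exact: (gexp2_int c c0).
- exact: (lebesgue_gauss _ c c0).
Qed.

End Coordinates.

Set Implicit Arguments.
Unset Strict Implicit.

(** * Negative semidefiniteness from the eigenvalue conditions *)

Section Spectral.
Variables (R : realType) (N : nat).
Hypothesis N_gt1 : (1 < N)%N.
Implicit Types (A : 'M[R]_N) (u v w : 'cV[R]_N).

Local Notation total v := (\sum_(i < N) v i ord0).

Definition dotp u v : R := (u^T *m v) ord0 ord0.

Lemma dotpE u v : dotp u v = \sum_i u i ord0 * v i ord0.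
Proof. by rewrite /dotp mxE; apply: eq_bigr => i _; rewrite mxE. Qed.

Lemma dotpC u v : dotp u v = dotp v u.
Proof. by rewrite !dotpE; apply: eq_bigr => i _; rewrite mulrC. Qed.

Lemma dotpDl u v w : dotp (u + v) w = dotp u w + dotp v w.
Proof. by rewrite /dotp linearD mulmxDl mxE. Qed.

Lemma dotpZl k u v : dotp (k *: u) v = k * dotp u v.
Proof. by rewrite /dotp linearZ -scalemxAl mxE. Qed.

Lemma dotpDr u v w : dotp u (v + w) = dotp u v + dotp u w.
Proof. by rewrite dotpC dotpDl !(dotpC _ u). Qed.

Lemma dotpZr k u v : dotp u (k *: v) = k * dotp u v.
Proof. by rewrite dotpC dotpZl dotpC. Qed.

Lemma dotp_mulmx A u v : dotp (A *m u) v = dotp u (A^T *m v).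
Proof. by rewrite /dotp trmx_mul mulmxA. Qed.

Lemma dotp_ge0 v : 0 <= dotp v v.
Proof. by rewrite dotpE sumr_ge0// => i _; rewrite -expr2 sqr_ge0. Qed.

Lemma dotp_eq0 v : (dotp v v == 0) = (v == 0).
Proof.
apply/eqP/eqP => [|->]; last by rewrite dotpE big1// => i _; rewrite mxE mul0r.
rewrite dotpE => /eqP; rewrite psumr_eq0 => [|i _]; last by rewrite -expr2 sqr_ge0.
move=> /allP v0; apply/colP => i; rewrite mxE.
by have := v0 i (mem_index_enum _); rewrite -expr2 sqrf_eq0 => /eqP.
Qed.

Lemma natN_neq0 : (N%:R : R) != 0.
Proof. by rewrite pnatr_eq0 -lt0n (ltn_trans _ N_gt1). Qed.

Lemma Jmx_mulE v i : (Jmx R N *m v) i ord0 = v i ord0 - N%:R^-1 * total v.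
Proof.
rewrite mulmxBl mul1mx -scalemxAl !mxE; congr (_ - _ * _).
by apply: eq_bigr => j _; rewrite mxE mul1r.
Qed.

Lemma Jmx_id v : total v = 0 -> Jmx R N *m v = v.
Proof. by move=> v0; apply/colP => i; rewrite Jmx_mulE v0 mulr0 subr0. Qed.

Lemma total_Jmx v : total (Jmx R N *m v) = 0.
Proof.
under eq_bigr do rewrite Jmx_mulE.
rewrite sumrB sumr_const card_ord -mulrnAl -mulr_natr mulVf ?natN_neq0//.
by rewrite mul1r subrr.
Qed.

Lemma Jmx_sym : (Jmx R N)^T = Jmx R N.
Proof. by apply/matrixP => i j; rewrite !mxE eq_sym. Qed.

Definition rayleigh A v := dotp v (A *m v).

Lemma total_lin v w (t : R) : total v = 0 -> total w = 0 -> total (v + t *: w) = 0.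
Proof.
move=> v0 w0; under eq_bigr do rewrite !mxE.
by rewrite big_split /= -mulr_sumr v0 w0 mulr0 addr0.
Qed.

Lemma linear_term_eq0 (L q : R) : (forall t, 0 <= 2 * t * L + t ^+ 2 * q) -> L = 0.
Proof.
move=> h; apply/eqP; rewrite -sqrf_eq0 eq_le sqr_ge0 andbT.
(* At [t = - L / m] the quadratic equals [L ^+ 2 * (q - 2 * m) / m ^+ 2]. The choice of [m] makes
   [q - 2 * m] negative, which forces [L] to vanish. *)
pose m := `|q| + 1; have m0 : 0 < m by rewrite ltr_wpDl.
have := h (- L / m); have -> : 2 * (- L / m) * L + (- L / m) ^+ 2 * q =
    L ^+ 2 * (q - 2 * m) / m ^+ 2 by field; rewrite lt0r_neq0.
rewrite pmulr_lge0 ?invr_gt0 ?exprn_gt0// => Lq.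
have qm : q - 2 * m < 0 by have := ler_norm q; have := normr_ge0 q; rewrite /m; lra.
by rewrite -(nmulr_lge0 _ qm).
Qed.

(** First-order condition at a constrained maximum: the nonnegative form
    [s * dotp w w - rayleigh A w] vanishes at [v], so its linear term vanishes in every zero-sum
    direction [w]. Testing with the residual [s *: v - J A v], itself of zero sum, shows that the
    residual is zero. *)
Lemma rayleigh_max_eigen A s v : A^T = A -> total v = 0 ->
  rayleigh A v = s * dotp v v ->
  (forall w, total w = 0 -> rayleigh A w <= s * dotp w w) ->
  Jmx R N *m A *m Jmx R N *m v = s *: v.
Proof.
move=> sA v0 vs ws.
have crit w : total w = 0 -> s * dotp v w - dotp v (A *m w) = 0.
  move=> w0; apply: (@linear_term_eq0 _ (s * dotp w w - rayleigh A w)) => t.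
  have := ws _ (total_lin t v0 w0); rewrite /rayleigh mulmxDr -scalemxAr.
  rewrite !(dotpDl, dotpDr, dotpZl, dotpZr) -subr_ge0.
  have -> : dotp w (A *m v) = dotp v (A *m w) by rewrite dotpC dotp_mulmx sA.
  move: vs; rewrite /rayleigh => ->; rewrite (dotpC w v).
  by congr (0 <= _); ring.
pose w := s *: v + -1 *: (Jmx R N *m (A *m v)).
have w0 : total w = 0.
  by rewrite total_lin ?total_Jmx//; under eq_bigr do rewrite mxE;
    rewrite -mulr_sumr v0 mulr0.
have /eqP : dotp w w = 0.
  rewrite -(crit w w0) {1}/w dotpDl !dotpZl (dotp_mulmx (Jmx R N)) Jmx_sym Jmx_id//.
  by rewrite (dotp_mulmx A) sA mulN1r.
rewrite dotp_eq0 -!mulmxA (Jmx_id v0) => /eqP w00.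
by apply/esym/eqP; rewrite -subr_eq0 -scaleN1r; apply/eqP.
Qed.

Lemma exists_total0 : exists v, v != 0 /\ total v = 0.
Proof.
pose i0 : 'I_N := Ordinal (ltn_trans (ltn0Sn 0) N_gt1).
pose i1 : 'I_N := Ordinal N_gt1.
exists (delta_mx i0 ord0 - delta_mx i1 ord0); split.
  apply/eqP => /matrixP /(_ i0 ord0); rewrite !mxE !eqxx /= subr0 => /eqP.
  by rewrite oner_eq0.
under eq_bigr do rewrite !mxE !eqxx !andbT; rewrite sumrB.
have sumd (k : 'I_N) : \sum_(i < N) (i == k)%:R = 1 :> R.
  by rewrite (bigD1 k)//= eqxx big1 ?addr0// => i /negbTE ->.
by rewrite !sumd subrr.
Qed.

Lemma dotp_gt0 v : v != 0 -> 0 < dotp v v.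
Proof. by move=> v0; rewrite lt0r dotp_eq0 v0 dotp_ge0. Qed.

Lemma dotp_normalize v : v != 0 ->
  (Num.sqrt (dotp v v))^-1 ^+ 2 * dotp v v = 1.
Proof.
by move=> /dotp_gt0 v0; rewrite exprVn sqr_sqrtr ?ltW// mulVf ?lt0r_neq0.
Qed.

Lemma totalZ k v : total v = 0 -> total (k *: v) = 0.
Proof.
by move=> v0; under eq_bigr do rewrite mxE; rewrite -mulr_sumr v0 mulr0.
Qed.

Lemma rayleigh_sphere_max A : exists v, total v = 0 /\ dotp v v = 1 /\
  forall w, total w = 0 -> dotp w w = 1 -> rayleigh A w <= rayleigh A v.
Proof.
(* Row vectors are used because the extreme value theorem applied below is stated for them. *)
pose K := [set r : 'rV[R]_N | total r^T = 0 /\ dotp r^T r^T = 1].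
have cc i : continuous (fun r : 'rV[R]_N => r ord0 i) by exact: coord_continuous.
have csum (F : 'I_N -> 'rV[R]_N -> R) :
    (forall i, continuous (F i)) -> continuous (fun r => \sum_i F i r).
  by move=> cF; apply: continuous_big => //; exact: add_continuous.
have cmul (f g : 'rV[R]_N -> R) : continuous f -> continuous g ->
    continuous (fun r => f r * g r).
  by move=> cf cg r; apply: continuousM; [exact: cf|exact: cg].
have c1 : continuous (fun r : 'rV[R]_N => total r^T).
  by under eq_fun do under eq_bigr do rewrite mxE; exact: csum.
have cdot (f g : 'rV[R]_N -> 'cV[R]_N) :
    (forall i, continuous (fun r => f r i ord0)) ->
    (forall i, continuous (fun r => g r i ord0)) ->
    continuous (fun r => dotp (f r) (g r)).
  move=> cf cg; under eq_fun do rewrite dotpE.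
  by apply: csum => i; apply: cmul.
have ct i : continuous (fun r : 'rV[R]_N => r^T i ord0).
  by under eq_fun do rewrite mxE; exact: cc.
have c2 : continuous (fun r : 'rV[R]_N => dotp r^T r^T) by exact: cdot.
have c3 : continuous (fun r : 'rV[R]_N => rayleigh A r^T).
  apply: cdot => // i; under eq_fun do rewrite mxE.
  by apply: csum => j; apply: cmul => //; exact: cst_continuous.
have [||r] := @EVT_max_rV R N (fun r => rayleigh A r^T) K _ _ (continuous_subspaceT c3).
- have [v [vN0 v0]] := exists_total0.
  exists ((Num.sqrt (dotp v v))^-1 *: v)^T; rewrite /K /= trmxK.
  by rewrite totalZ// dotpZl dotpZr mulrA -expr2 dotp_normalize.
- apply: bounded_closed_compact.
    exists 1; split=> // M M1 r [_ r1] /=; rewrite /Num.norm /= mx_normrE.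
    apply: bigmax_le => [|[i j] _ /=]; first by rewrite ltW// (lt_trans ltr01).
    (* Each squared coordinate is at most the sum of all of them, which is 1. *)
    apply: le_trans (ltW M1); rewrite ord1 -(@expr_le1 _ 2)//.
    rewrite real_normK ?num_real// -r1 dotpE (bigD1 j)//= mxE -expr2 lerDl.
    by apply: sumr_ge0 => k _; rewrite -expr2 sqr_ge0.
  have -> : K = (fun r => total r^T) @^-1` [set 0] `&`
      (fun r => dotp r^T r^T) @^-1` [set 1].
    by apply/seteqP; split.
  apply: closedI; apply: preimage_closed.
  - by move=> x _; exact: c1.
  - exact: closed_eq.
  - by move=> x _; exact: c2.
  - exact: closed_eq.
rewrite inE => -[r0 r1] rmax; exists r^T; split=> //; split=> // w w0 w1.
by have := rmax w^T; rewrite inE trmxK; apply; rewrite /K /= trmxK.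
Qed.

(** Provides the extremal eigenvalue to which the implications in [ab_cond] can be applied, together
    with its variational bound. The bound passes from the unit sphere to all zero-sum vectors by
    homogeneity. *)
Lemma eig_perp_greatest A : A^T = A -> exists s,
  is_greatest (eig_perp (Jmx R N *m A *m Jmx R N)) s /\
  forall w, total w = 0 -> rayleigh A w <= s * dotp w w.
Proof.
move=> sA; have [v [v0 [v1 vmax]]] := rayleigh_sphere_max A.
have ws w : total w = 0 -> rayleigh A w <= rayleigh A v * dotp w w.
  move=> w0; have [->|wN0] := eqVneq w 0.
    by rewrite /rayleigh mulmx0 (_ : dotp 0 0 = 0) ?mulr0//; apply/eqP; rewrite dotp_eq0.
  have := vmax _ (totalZ (Num.sqrt (dotp w w))^-1 w0).
  rewrite /rayleigh -scalemxAr !dotpZl !dotpZr !mulrA -expr2.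
  move=> /(_ (dotp_normalize wN0)) h.
  rewrite -[leLHS]mul1r -(dotp_normalize wN0) (mulrC _ (dotp w w)) -mulrA.
  by rewrite mulrC ler_wpM2r// dotp_ge0.
exists (rayleigh A v); split=> //; split.
  exists v; split; first by rewrite -dotp_eq0 v1 oner_eq0.
  by split=> //; apply: rayleigh_max_eigen => //; rewrite v1 mulr1.
move=> s [w [wN0 [w0 ew]]].
have ww0 := dotp_gt0 wN0.
rewrite -(ler_pM2r ww0); apply: le_trans (ws w w0).
rewrite -dotpZr -ew -!mulmxA (Jmx_id w0) /rayleigh dotpC dotp_mulmx Jmx_sym.
by rewrite (Jmx_id w0) dotpC.
Qed.

End Spectral.

(** * From the eigenvalue conditions to the signs of the coefficient forms *)

Section Conditions.
Variables (R : realType) (N : nat) (sigma : 'I_N -> 'I_N -> R) (alpha beta : R).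
Hypotheses (N_gt1 : (1 < N)%N) (sigmaC : forall i j, sigma i j = sigma j i).

(** Zero-sum vectors satisfy [M v = - v], since the other entries sum to the opposite of the missing
    one. As [N > 1] a nonzero such vector exists, so -1 is attained and serves as both [mmin] and
    [mmax]. *)
Lemma eig_perp_mob x :
  eig_perp (Jmx R N *m mob_mx R N *m Jmx R N) x <-> x = -1.
Proof.
have mobE (v : 'cV[R]_N) : \sum_(i < N) v i ord0 = 0 -> mob_mx R N *m v = - v.
  move=> v0; apply/colP => i; rewrite !mxE (bigD1 i)//= !mxE eqxx mul0r add0r.
  move: v0; rewrite (bigD1 i)//= => /eqP; rewrite addr_eq0 => /eqP ->.
  rewrite opprK; apply: eq_bigr => j ji.
  by rewrite mxE eq_sym (negbTE ji) mul1r.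
have JMJ (v : 'cV[R]_N) : \sum_(i < N) v i ord0 = 0 ->
    Jmx R N *m mob_mx R N *m Jmx R N *m v = - v.
  by move=> v0; rewrite -!mulmxA (Jmx_id v0) mobE// mulmxN Jmx_id.
split=> [[v [vN0 [v0]]]|->].
  rewrite JMJ// -scaleN1r => /eqP; rewrite -subr_eq0 -scalerBl scaler_eq0.
  by rewrite (negbTE vN0) orbF subr_eq0 => /eqP.
have [v [vN0 v0]] := exists_total0 R N_gt1.
by exists v; rewrite JMJ// scaleN1r.
Qed.

Lemma sigma_mx_sym : (sigma_mx sigma)^T = sigma_mx sigma.
Proof.
by apply/matrixP => i j; rewrite !mxE eq_sym; case: ifP => // _; exact: sigmaC.
Qed.

Lemma rayleigh_sigma_mx (v : 'I_N -> R) :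
  rayleigh (sigma_mx sigma) (\col_i v i) =
  \sum_i \sum_(j | j != i) sigma i j * (v i * v j).
Proof.
rewrite /rayleigh dotpE; apply: eq_bigr => i _.
rewrite !mxE mulr_sumr [RHS]big_mkcond; apply: eq_bigr => j _.
rewrite !mxE eq_sym; case: ifP => _ /=; [by rewrite mul0r mulr0|by ring].
Qed.

(** Evaluates the reciprocal mobility part of the coefficient forms. *)
Lemma offdiag_sum (v : 'I_N -> R) : \sum_i v i = 0 ->
  \sum_i \sum_(j | j != i) v i * v j = - \sum_i v i ^+ 2.
Proof.
move=> v0; rewrite -sumrN; apply: eq_bigr => i _; rewrite -mulr_sumr.
move: v0; rewrite (bigD1 i)//= => /eqP; rewrite addrC addr_eq0 => /eqP ->.
by rewrite mulrN.
Qed.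

Hypothesis ab : ab_cond sigma alpha beta.

Lemma sigma_form_bounds (v : 'I_N -> R) : \sum_i v i = 0 ->
  - alpha * (\sum_i v i ^+ 2) <= \sum_i \sum_(j | j != i) sigma i j * (v i * v j)
    <= - beta * (\sum_i v i ^+ 2).
Proof.
move=> v0; have [_ [_ [_ [amin bmax]]]] := ab.
have mmax : is_greatest (eig_perp (Jmx R N *m mob_mx R N *m Jmx R N)) (-1).
  by split=> [|x /eig_perp_mob ->//]; exact/eig_perp_mob.
have mmin : is_least (eig_perp (Jmx R N *m mob_mx R N *m Jmx R N)) (-1).
  by split=> [|x /eig_perp_mob ->//]; exact/eig_perp_mob.
have tv : \sum_(i < N) (\col_i v i) i ord0 = 0.
  by under eq_bigr do rewrite mxE.
have dv : dotp (\col_i v i) (\col_i v i) = \sum_i v i ^+ 2.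
  by rewrite dotpE; apply: eq_bigr => i _; rewrite mxE -expr2.
have v20 : 0 <= \sum_i v i ^+ 2 by apply: sumr_ge0 => i _; exact: sqr_ge0.
have [s [smax /(_ _ tv)]] := eig_perp_greatest N_gt1 sigma_mx_sym.
rewrite rayleigh_sigma_mx dv => sv.
have sN : (- sigma_mx sigma)^T = - sigma_mx sigma by rewrite linearN /= sigma_mx_sym.
(* The least eigenvalue of [sigma_mx] is obtained as the opposite of the greatest eigenvalue of
   [- sigma_mx]. *)
have [t [[tE tmax] /(_ _ tv)]] := eig_perp_greatest N_gt1 sN.
rewrite /rayleigh mulNmx -scaleN1r dotpZr -/(rayleigh _ _) rayleigh_sigma_mx dv => tv'.
have tmin : is_least (eig_perp (Jmx R N *m sigma_mx sigma *m Jmx R N)) (- t).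
  have opp_eig (x : R) (A : 'M[R]_N) : eig_perp (Jmx R N *m A *m Jmx R N) x ->
      eig_perp (Jmx R N *m (- A) *m Jmx R N) (- x).
    move=> [w [wN0 [w0 ew]]]; exists w; split=> //; split=> //.
    by rewrite mulmxN !mulNmx ew scaleNr.
  split=> [|x /opp_eig]; first by rewrite -[sigma_mx _]opprK; exact: opp_eig.
  by move=> /tmax; rewrite lerNl.
have := amin _ _ tmin mmax; have := bmax _ _ smax mmin.
rewrite invrN1 !mulrN1 opprK => bs ta; apply/andP; split.
- rewrite mulNr lerNl; apply: le_trans (_ : t * \sum_i v i ^+ 2 <= _).
    by rewrite -mulN1r.
  by rewrite ler_wpM2r.
- by apply: le_trans sv _; rewrite ler_wpM2r// lerNr.
Qed.

Local Notation mob := (fun _ _ : 'I_N => 1 : R).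

(** Up to a nonnegative factor the form is the [sigma] form plus [beta] times the squared norm, and
    the upper bound of [sigma_form_bounds] applies; for [bcoef] the lower bound plays this part. *)
Lemma acoef_form_le0 (v : 'I_N -> R) : \sum_i v i = 0 ->
  \sum_i \sum_(j | j != i) acoef sigma mob alpha beta i j * (v i * v j) <= 0.
Proof.
move=> v0; have [b0 [ba _]] := ab; have /andP[_ ub] := sigma_form_bounds v0.
have -> : \sum_i \sum_(j | j != i) acoef sigma mob alpha beta i j * (v i * v j) =
    Num.sqrt pi * Num.sqrt alpha / (alpha - beta) *
    (\sum_i \sum_(j | j != i) sigma i j * (v i * v j) + beta * \sum_i v i ^+ 2).
  rewrite -[\sum_i v i ^+ 2]opprK -offdiag_sum// mulrN -mulNr mulr_sumr -big_split.
  rewrite mulr_sumr; apply: eq_bigr => i _ /=.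
  rewrite mulr_sumr -big_split mulr_sumr; apply: eq_bigr => j _ /=.
  by rewrite /acoef invr1; ring.
rewrite mulr_ge0_le0 ?divr_ge0 ?mulr_ge0 ?sqrtr_ge0 ?subr_ge0 ?(ltW ba)//.
by move: ub; rewrite mulNr; lra.
Qed.

Lemma bcoef_form_le0 (v : 'I_N -> R) : \sum_i v i = 0 ->
  \sum_i \sum_(j | j != i) bcoef sigma mob alpha beta i j * (v i * v j) <= 0.
Proof.
move=> v0; have [b0 [ba _]] := ab; have /andP[lb _] := sigma_form_bounds v0.
have -> : \sum_i \sum_(j | j != i) bcoef sigma mob alpha beta i j * (v i * v j) =
    Num.sqrt pi * Num.sqrt beta / (alpha - beta) *
    (- (\sum_i \sum_(j | j != i) sigma i j * (v i * v j)) - alpha * \sum_i v i ^+ 2).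
  rewrite -[\sum_i v i ^+ 2]opprK -offdiag_sum// mulrN opprK -sumrN mulr_sumr -big_split.
  rewrite mulr_sumr; apply: eq_bigr => i _ /=.
  rewrite -sumrN mulr_sumr -big_split mulr_sumr; apply: eq_bigr => j _ /=.
  by rewrite /bcoef invr1; ring.
rewrite mulr_ge0_le0 ?divr_ge0 ?mulr_ge0 ?sqrtr_ge0 ?subr_ge0 ?(ltW ba)//.
by move: lb; rewrite mulNr; lra.
Qed.

Lemma acoefC i j : acoef sigma mob alpha beta i j = acoef sigma mob alpha beta j i.
Proof. by rewrite /acoef sigmaC. Qed.

Lemma bcoefC i j : bcoef sigma mob alpha beta i j = bcoef sigma mob alpha beta j i.
Proof. by rewrite /bcoef sigmaC. Qed.

End Conditions.

(** * Symmetry of the Read-Shockley tensions *)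

Section Tensions.
Variable R : realType.

Lemma sigma2C N (f : R -> R) (theta : 'I_N -> R) i j :
  sigma2 f theta i j = sigma2 f theta j i.
Proof.
rewrite /sigma2; congr inf.
have sub i' j' : [set f `|theta i' - theta j' + k%:~R * (pi / 2)| | k in [set: int]] `<=`
    [set f `|theta j' - theta i' + k%:~R * (pi / 2)| | k in [set: int]].
  (* Exchanging the two grains is compensated by [k -> - k]. *)
  move=> _ [k _ <-]; exists (- k) => //; congr f; rewrite -normrN; congr `|_|.
  by rewrite mulrNz; ring.
by apply/seteqP; split; exact: sub.
Qed.

Lemma octa_tr (r : 'M[R]_3) : octa r -> octa r^T.
Proof.
move=> [[rr rd] re]; split; last by move=> i j; rewrite mxE.
by split; [rewrite trmxK; exact: mulmx1C|rewrite det_tr].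
Qed.

(** The rotation angle depends only on the trace, and [tr (r g) = tr (r^T g^T)] by transposition and
    cyclicity. Since the octahedral group is closed under transposition, one-sided minimization
    still gives a symmetric misorientation. *)
Lemma thetaO_tr (g : 'M[R]_3) : thetaO g^T = thetaO g.
Proof.
rewrite /thetaO; congr inf.
have sub (h : 'M[R]_3) :
    [set rot_angle (r *m h) | r in @octa R] `<=`
    [set rot_angle (r *m h^T) | r in @octa R].
  move=> _ [r ro <-]; exists r^T; first exact: octa_tr.
  by rewrite /rot_angle -trmx_mul mxtrace_tr mxtrace_mulC.
by apply/seteqP; split; [rewrite -{2}[g]trmxK|]; exact: sub.
Qed.

Lemma sigma3C N (ts : R) (g : 'I_N -> 'M[R]_3) i j :
  sigma3 ts g i j = sigma3 ts g j i.
Proof. by rewrite /sigma3 -thetaO_tr trmx_mul trmxK. Qed.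

End Tensions.

Theorem theorem4p5 (R : realType) :
  (* d = 2, model (RS2) *)
  (forall (N : nat) (f : R -> R) (theta : 'I_N -> R) (B : 'M[R]_2)
          (alpha beta dt : R),
     (2 <= N)%N ->
     RS2_f f ->
     (forall i, - (pi / 4) < theta i <= pi / 4) ->
     (forall i j, i != j -> theta i != theta j) ->
     \det B != 0 ->
     ab_cond (sigma2 f theta) alpha beta ->
     0 < dt ->
     gradient_stable (@leb2 R) (@coord2 R) (@mk2 R)
       (sigma2 f theta) (fun _ _ => 1) alpha beta B dt) /\
  (* d = 3, model (RS3) with theta_* <= pi/4 *)
  (forall (N : nat) (ts : R) (g : 'I_N -> 'M[R]_3) (B : 'M[R]_3)
          (alpha beta dt : R),
     (2 <= N)%N ->
     0 < ts <= pi / 4 ->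
     (forall i, SO3 (g i)) ->
     (forall i j, i != j -> 0 < thetaO (g i *m (g j)^T)) ->
     \det B != 0 ->
     ab_cond (sigma3 ts g) alpha beta ->
     0 < dt ->
     gradient_stable (@leb3 R) (@coord3 R) (@mk3 R)
       (sigma3 ts g) (fun _ _ => 1) alpha beta B dt).
Proof.
split.
- move=> N f theta B alpha beta dt N2 _ _ _ detB ab dt0.
  have [b0 [ba _]] := ab.
  apply: (gradient_stable_of_forms R _ (pt2 R)
    (@sigma_finite_prod R _ _ _ _ (@lebesgue_measure R) (@lebesgue_measure R))
    2 (@coord2 R) (@mk2 R) (mk2K R) (coord2_inj R) (measurable_coord2 R)
    (measurable_mk2 R) (ge0_integral_shift2 R) (gexp2_int R) B detB N
    (sigma2 f theta) _ alpha beta dt _ b0 dt0).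
  + exact: lt_trans ba.
  + by move=> i j _; apply: acoefC; exact: sigma2C.
  + by move=> i j _; apply: bcoefC; exact: sigma2C.
  + exact: acoef_form_le0 N2 (sigma2C f theta) ab.
  + exact: bcoef_form_le0 N2 (sigma2C f theta) ab.
- move=> N ts g B alpha beta dt N2 _ _ _ detB ab dt0.
  have [b0 [ba _]] := ab.
  apply: (gradient_stable_of_forms R _ (pt3 R)
    (@sigma_finite_prod R _ _ _ _ (@sigma_finite_prod R _ _ _ _
      (@lebesgue_measure R) (@lebesgue_measure R)) (@lebesgue_measure R))
    3 (@coord3 R) (@mk3 R) (mk3K R) (coord3_inj R) (measurable_coord3 R)
    (measurable_mk3 R) (ge0_integral_shift3 R) (gexp3_int R) B detB N
    (sigma3 ts g) _ alpha beta dt _ b0 dt0).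
  + exact: lt_trans ba.
  + by move=> i j _; apply: acoefC; exact: sigma3C.
  + by move=> i j _; apply: bcoefC; exact: sigma3C.
  + exact: acoef_form_le0 N2 (sigma3C ts g) ab.
  + exact: bcoef_form_le0 N2 (sigma3C ts g) ab.
Qed.
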